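(* Let $a,b$ be positive integers, $B>1$ an integer, $z\in\mathbb{C}$ with $|z|\le1$, and $l\in\{0,1\}$, with $(z-1)^2+(l-1)^2\neq0$ (i.e. not both $z=1$ and $l=1$). Define $(a_{k,l})_{k\ge0}$ by $$\frac{1}{1-x}\sum_{k=0}^{\infty}\frac{x^{(b+al)B^k}(1-x^{B^k})}{(1-zx^{aB^k})^{l+1}}=\sum_{k=0}^{\infty}a_{k,l}x^k .$$ Then $$\gamma_{a,b}^{(l)}(z)=\frac12\int_0^1\frac{x^{b+al-1}(1-x)}{(1-zx^a)^{l+1}}\,dx+\sum_{k=1}^{\infty}a_{k,l}\frac{P_B(k)}{Bk(Bk+1)\cdots(Bk+B)} .$$
   Context: For positive reals $a,b$ and $|z|\le1$, $\gamma_{a,b}(z)=\sum_{n=0}^{\infty}\left(\frac{1}{an+b}-\log\frac{an+b+1}{an+b}\right)z^n$; it extends analytically to $\mathbb{C}\setminus[1,+\infty)$, $\gamma^{(0)}_{a,b}=\gamma_{a,b}$ and $\gamma^{(1)}_{a,b}=\gamma'_{a,b}$ is the $z$-derivative. $P_B(x)=(Bx+1)(Bx+2)\cdots(Bx+B-1)\sum_{m=1}^{B-1}\frac{m(B-m)}{Bx+m}$, a polynomial of degree $B-2$. *)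

(* Defs.v *)
(* Stdlib reals with Coquelicot. *)
From Stdlib Require Export Reals.
From Coquelicot Require Export Coquelicot.

Open Scope R_scope.

Definition gamma_coef (a b : R) (n : nat) : R :=
  1 / (a * INR n + b) - ln ((a * INR n + b + 1) / (a * INR n + b)).

(* [g] is the function gamma_{a,b}: the sum of its series on the closed unit
   disc (including z = 1) and, on C minus the ray [1, +oo), its analytic
   extension.  The value of [g] at real z > 1 is left free. *)
Definition is_gamma (a b : R) (g : C -> C) : Prop :=
  (forall z : C, Cmod z <= 1 ->
     is_pseries (K := C_AbsRing) (V := C_NormedModule)
       (fun n => RtoC (gamma_coef a b n)) z (g z)) /\
  (forall z : C, ~ (Im z = 0 /\ 1 <= Re z) ->
     ex_derive (K := C_AbsRing) (V := C_NormedModule) g z).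

(* [v] is the l-th complex derivative of [g] at [z]; only l = 0 and l = 1
   are meaningful. *)
Definition is_deriv01 (g : C -> C) (l : nat) (z v : C) : Prop :=
  match l with
  | 0%nat => g z = v
  | 1%nat => is_derive (K := C_AbsRing) (V := C_NormedModule) g z v
  | _ => False
  end.

(* P_B(x) for B >= 2, written as in its product-times-sum form; as a function
   on R this agrees with the polynomial away from the points x = - m / B,
   0 < m < B.  The product has the B - 1 factors B x + 1, ..., B x + (B - 1). *)
Definition P (B : nat) (x : R) : R :=
  prod_f_R0 (fun j => INR B * x + INR (j + 1)) (B - 2) *
  sum_n_m (fun m => INR m * (INR B - INR m) / (INR B * x + INR m)) 1 (B - 1).

(* Bx (Bx + 1) ... (Bx + B), with B + 1 factors. *)
Definition Q (B : nat) (x : R) : R :=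
  prod_f_R0 (fun j => INR B * x + INR j) B.

Definition gen_term (a b B l : nat) (z x : C) (k : nat) : C :=
  (Cpow x ((b + a * l) * B ^ k) * (1 - Cpow x (B ^ k))
   / Cpow (1 - z * Cpow x (a * B ^ k)) (l + 1))%C.

(* [c] is the sequence (a_{k,l})_k of Taylor coefficients at 0 of
   1/(1-x) * sum_k gen_term k, on the open unit disc. *)
Definition is_gen_coef (a b B l : nat) (z : C) (c : nat -> C) : Prop :=
  forall x : C, Cmod x < 1 ->
  exists S : C,
    is_series (K := C_AbsRing) (V := C_NormedModule) (gen_term a b B l z x) S /\
    is_pseries (K := C_AbsRing) (V := C_NormedModule) c x (1 / (1 - x) * S)%C.

(* When z = 1 the denominator vanishes at the endpoint x = 1, where division
   by zero gives a finite value; a single point does not affect the Riemann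
   integral. *)
Definition integrand (a b l : nat) (z : C) (x : R) : C :=
  (Cpow (RtoC x) (b + a * l - 1) * (1 - RtoC x)
   / Cpow (1 - z * Cpow (RtoC x) a) (l + 1))%C.

(* Main.v *)
(* Write [N = a n + b + a l].  The integral contributes to the n-th coefficient
   half of [1/N - 1/(N + 1)], so what remains of the gamma series has the
   coefficients [h N], where [h x = (1/x + 1/(x + 1))/2 - ln ((x + 1)/x)] is the
   error of the trapezoidal rule for [1/t] on [x, x + 1]; it is [O(x^-3)].
   Refining the step from [1] to [1/B] gives
   [h k - sum_(m < B) h (B k + m) = P B k / Q B k], while the functional equation
   of the generating function under [x -> x^B] says [c k = e k + c (k / B)],
   where [e] is [(n + 1)^l z^n] at [k = N] and [0] elsewhere.  Summation by parts
   then turns [sum c k * (P B k / Q B k)] into [sum e k * h k].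

   For [l = 1] and [|z| = 1] the differentiated gamma series converges only
   conditionally.  Instead, the integral and the series of the [h N], which
   together represent [g] on the closed disc, are expanded to first order
   along the segment from [z] to [1]. *)
Require Import Defs.
From Stdlib Require Import Lia Lra Wf_nat.

Local Notation is_Cseries := (is_series (K := C_AbsRing) (V := C_NormedModule)).

(** * Complex series through partial sums *)

(** Counting the terms, instead of naming the last index as [sum_n] does, provides an empty sum and
    lets blocks of length [B] fit without off-by-one corrections. *)
Fixpoint psum (u : nat -> C) (n : nat) : C :=
  match n with
  | O => RtoC 0
  | S m => (psum u m + u m)%C
  end.

Lemma sum_n_psum (u : nat -> C) (n : nat) :
  sum_n (G := C_AbelianMonoid) u n = psum u (S n).
Proof.
  induction n as [|n IH].
  - rewrite sum_O; simpl; ring.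
  - rewrite sum_Sn, IH; reflexivity.
Qed.

Lemma is_series_psum (u : nat -> C) (l : C) :
  is_Cseries u l <-> is_lim_seq (fun n => Cmod (psum u n - l)) 0.
Proof.
  rewrite (is_lim_seq_incr_1 (fun n => Cmod (psum u n - l))).
  unfold is_series; rewrite (filterlim_locally_ball_norm (U := C_NormedModule)).
  rewrite <- is_lim_seq_spec; unfold is_lim_seq'.
  assert (E : forall n (e : R), ball_norm (V := C_NormedModule) l e (sum_n u n)
     <-> Rabs (Cmod (psum u (S n) - l) - 0) < e).
  { intros n e; rewrite Rminus_0_r, Rabs_pos_eq by apply Cmod_ge_0.
    unfold ball_norm; rewrite <- sum_n_psum; reflexivity. }
  split; intros H e; destruct (H e) as [N HN]; exists N; intros n Hn;
    apply E, HN, Hn.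
Qed.

Lemma is_lim_seq_squeeze0 (u v : nat -> R) :
  (forall n, 0 <= u n <= v n) -> is_lim_seq v 0 -> is_lim_seq u 0.
Proof.
  intros H Hv.
  apply (is_lim_seq_le_le (fun _ => 0) u v); [exact H | apply is_lim_seq_const | exact Hv].
Qed.

Lemma Cseries_unique (u : nat -> C) (l m : C) :
  is_Cseries u l -> is_Cseries u m -> l = m.
Proof.
  apply (filterlim_locally_unique (F := eventually)).
Qed.

(** The partial sums of [v] follow those of [u] along indices tending to infinity, up to a null
    error. This serves both for inserting zeros into a series and for summation by parts. *)
Lemma Cseries_psum_compare (u v : nat -> C) (l : C) (phi : nat -> nat) (e : nat -> R) :
  is_Cseries u l -> filterlim phi eventually eventually ->
  is_lim_seq e 0 ->
  (forall n, Cmod (psum v n - psum u (phi n)) <= e n) -> is_Cseries v l.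
Proof.
  rewrite !is_series_psum; intros Hu Hphi He H.
  apply is_lim_seq_squeeze0 with (fun n => e n + Cmod (psum u (phi n) - l)).
  - intros n; split; [apply Cmod_ge_0|].
    replace (psum v n - l)%C with ((psum v n - psum u (phi n)) + (psum u (phi n) - l))%C by ring.
    eapply Rle_trans; [apply Cmod_triangle|]; specialize (H n); lra.
  - replace (Finite 0) with (Finite (0 + 0)) by (f_equal; ring).
    apply is_lim_seq_plus'; [exact He|].
    exact (filterlim_comp _ _ _ phi (fun n => Cmod (psum u n - l)) _ _ _ Hphi Hu).
Qed.

Lemma psum_ext (u v : nat -> C) (n : nat) :
  (forall k, (k < n)%nat -> u k = v k) -> psum u n = psum v n.
Proof.
  induction n as [|n IH]; simpl; intros H; [reflexivity|].
  rewrite IH, H; auto with arith.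
Qed.

Lemma Cseries_ext (u v : nat -> C) (l : C) :
  (forall n, u n = v n) -> is_Cseries u l -> is_Cseries v l.
Proof. apply is_series_ext. Qed.

Lemma Cseries_plus (u v : nat -> C) (l m : C) :
  is_Cseries u l -> is_Cseries v m -> is_Cseries (fun n => u n + v n)%C (l + m)%C.
Proof. apply (is_series_plus (K := C_AbsRing) (V := C_NormedModule)). Qed.

Lemma Cseries_scal (c : C) (u : nat -> C) (l : C) :
  is_Cseries u l -> is_Cseries (fun n => c * u n)%C (c * l)%C.
Proof. apply (is_series_scal (K := C_AbsRing) (V := C_NormedModule)). Qed.

Lemma Cseries_minus (u v : nat -> C) (l m : C) :
  is_Cseries u l -> is_Cseries v m -> is_Cseries (fun n => u n - v n)%C (l - m)%C.
Proof. apply (is_series_minus (K := C_AbsRing) (V := C_NormedModule)). Qed.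

Lemma psum_S_l (u : nat -> C) (n : nat) :
  psum u (S n) = (u 0%nat + psum (fun k => u (S k)) n)%C.
Proof.
  induction n as [|n IH]; [simpl; ring|].
  change (psum u (S (S n))) with (psum u (S n) + u (S n))%C.
  rewrite IH; simpl; ring.
Qed.

Lemma Cseries_shift (u : nat -> C) (l : C) :
  is_Cseries u l <-> is_Cseries (fun n => u (S n)) (l - u 0%nat)%C.
Proof.
  rewrite !is_series_psum, (is_lim_seq_incr_1 (fun n => Cmod (psum u n - l))).
  split; apply is_lim_seq_ext; intros n; f_equal; rewrite psum_S_l; ring.
Qed.

Lemma Cseries_Cmod_le (u : nat -> C) (l : C) (M : R) :
  is_Cseries u l -> (forall n, Cmod (psum u n) <= M) -> Cmod l <= M.
Proof.
  intros Hu H; apply is_series_psum in Hu.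
  rewrite <- (Rplus_0_r M).
  refine (is_lim_seq_le (fun _ => Cmod l) (fun n => M + Cmod (psum u n - l))
          (Cmod l) (M + 0) _ _ _).
  - intros n; replace l with (psum u n + - (psum u n - l))%C at 1 by ring.
    eapply Rle_trans; [apply Cmod_triangle|]; rewrite Cmod_opp.
    specialize (H n); lra.
  - apply is_lim_seq_const.
  - apply is_lim_seq_plus'; [apply is_lim_seq_const | exact Hu].
Qed.

Lemma is_lim_seq_inv_S : is_lim_seq (fun n => / INR (S n)) 0.
Proof.
  apply (is_lim_seq_incr_1 (fun n => / INR n)).
  replace (Finite 0) with (Rbar_inv p_infty) by reflexivity.
  apply is_lim_seq_inv; [apply is_lim_seq_INR | discriminate].
Qed.

Lemma Cseries_exists (u : nat -> C) (K : R) :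
  (forall n, Cmod (u n) <= K * / (INR (n + 1) * INR (n + 2))) -> exists l : C, is_Cseries u l.
Proof.
  intros H.
  apply (ex_series_le (K := C_AbsRing) (V := C_CompleteNormedModule) u
    (fun n => K * / (INR (n + 1) * INR (n + 2))) H).
  apply (ex_series_scal (K := R_AbsRing) (V := R_NormedModule) K).
  exists 1.
  change (is_lim_seq (sum_n (fun n => / (INR (n + 1) * INR (n + 2)))) 1).
  (* The comparison series telescopes: its general term is [1/(n+1) - 1/(n+2)]. *)
  apply is_lim_seq_ext with (fun n => 1 - / INR (S (S n))).
  - induction n as [|n IH].
    + rewrite sum_O; simpl; field.
    + rewrite sum_Sn, <- IH;
      replace (S n + 1)%nat with (S (S n)) by lia.
      replace (S n + 2)%nat with (S (S (S n))) by lia.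
      match goal with |- _ = plus ?a ?b => change (plus a b) with (a + b) end.
      rewrite !S_INR; pose proof (pos_INR n); field; lra.
  - replace (Finite 1) with (Finite (1 - 0)) by (f_equal; ring).
    apply is_lim_seq_minus'; [apply is_lim_seq_const|].
    apply (is_lim_seq_incr_1 (fun n => / INR (S n))), is_lim_seq_inv_S.
Qed.

(** Coefficient sequence of [x^N0] times the power series of [v] in [x^a]: the entry [v n] sits at
    index [a n + N0]. *)
Definition spread (a N0 : nat) (v : nat -> C) (k : nat) : C :=
  if (N0 <=? k)%nat then
    if ((k - N0) mod a =? 0)%nat then v ((k - N0) / a)%nat else RtoC 0
  else RtoC 0.

(** The number of indices [a j + N0] below [n] is the ceiling of [(n - N0) / a]; truncated
    subtraction makes it 0 when [n <= N0]. *)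
Lemma psum_spread (a N0 : nat) (v : nat -> C) (n : nat) :
  (0 < a)%nat ->
  psum (spread a N0 v) n = psum v ((n - N0 + (a - 1)) / a)%nat.
Proof.
  intros Ha; induction n as [|n IH].
  - simpl; rewrite Nat.div_small by lia; reflexivity.
  - change (psum (spread a N0 v) (S n)) with (psum (spread a N0 v) n + spread a N0 v n)%C.
    rewrite IH; clear IH; unfold spread.
    destruct (Nat.leb_spec N0 n) as [H|H].
    + replace (S n - N0)%nat with (S (n - N0)) by lia.
      set (m := (n - N0)%nat).
      pose proof (Nat.div_mod_eq m a) as E; pose proof (Nat.mod_upper_bound m a ltac:(lia)) as L.
      set (q := (m / a)%nat) in *; set (r := (m mod a)%nat) in *.
      destruct (Nat.eqb_spec r 0) as [Hr|Hr].
      * rewrite <- (Nat.div_unique (m + (a - 1)) a q (a - 1)) by lia.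
        rewrite <- (Nat.div_unique (S m + (a - 1)) a (S q) 0) by lia.
        reflexivity.
      * rewrite <- (Nat.div_unique (m + (a - 1)) a (S q) (r - 1)) by lia.
        rewrite <- (Nat.div_unique (S m + (a - 1)) a (S q) r) by lia.
        ring.
    + replace (S n - N0)%nat with 0%nat by lia; replace (n - N0)%nat with 0%nat by lia.
      ring.
Qed.

Lemma Cseries_spread (a N0 : nat) (v : nat -> C) (l : C) :
  (0 < a)%nat -> is_Cseries v l -> is_Cseries (spread a N0 v) l.
Proof.
  intros Ha Hv.
  apply (Cseries_psum_compare v (spread a N0 v) l
           (fun n => (n - N0 + (a - 1)) / a)%nat (fun _ => 0)); auto.
  - intros P [N HN]; exists (a * N + N0)%nat; intros n Hn; apply HN.
    apply Nat.div_le_lower_bound; lia.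
  - apply is_lim_seq_const.
  - intros n; rewrite psum_spread by exact Ha.
    replace (_ - _)%C with (RtoC 0) by ring; rewrite Cmod_0; lra.
Qed.

Lemma spread_mult (a N0 : nat) (v f : nat -> C) (k : nat) :
  (0 < a)%nat ->
  spread a N0 (fun n => v n * f (a * n + N0)%nat)%C k = (spread a N0 v k * f k)%C.
Proof.
  intros Ha; unfold spread.
  destruct (Nat.leb_spec N0 k) as [H|H]; [|ring].
  destruct (Nat.eqb_spec ((k - N0) mod a) 0) as [E|E]; [|ring].
  pose proof (Nat.div_mod_eq (k - N0) a).
  replace (a * ((k - N0) / a) + N0)%nat with k by lia; reflexivity.
Qed.

(** * The trapezoidal error *)

(* Error of the trapezoidal rule for [1/t] on [x, x + 1]. *)
Definition trap_err (x : R) : R := (/ x + / (x + 1)) / 2 - (ln (x + 1) - ln x).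

(** In the variable [y = 1/x] the error is [phi y] with [phi 0 = 0] and
    [phi' t = t^2 / (2 (1+t)^2)], which lies between 0 and [y^2 / 2] on [[0, y]]. The mean value
    theorem adds one more factor [y]. *)
Lemma trap_err_bound (x : R) : 0 < x -> 0 <= trap_err x <= / (2 * x ^ 3).
Proof.
  intros Hx.
  set (phi := fun t => (t + t / (1 + t)) / 2 - ln (1 + t)).
  assert (E : trap_err x = phi (/ x)).
  { unfold trap_err, phi; rewrite <- ln_div by lra.
    replace ((x + 1) / x) with (1 + / x) by (field; lra).
    f_equal; field; lra. }
  assert (Hy : 0 < / x) by (apply Rinv_0_lt_compat, Hx).
  destruct (MVT_gen phi 0 (/ x) (fun t => t ^ 2 / (2 * (1 + t) ^ 2))) as [t [Ht Eq]].
  - rewrite Rmin_left, Rmax_right by lra; intros t Ht.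
    unfold phi; auto_derive; [lra | field; lra].
  - rewrite Rmin_left, Rmax_right by lra; intros t Ht.
    apply derivable_continuous_pt, ex_derive_Reals_0.
    unfold phi; auto_derive; lra.
  - rewrite Rmin_left, Rmax_right in Ht by lra.
    replace (phi 0) with 0 in Eq
      by (unfold phi; rewrite Rplus_0_r, ln_1; field).
    rewrite E; replace (phi (/ x)) with (t ^ 2 / (2 * (1 + t) ^ 2) * / x) by lra.
    assert (B : 0 <= t ^ 2 / (2 * (1 + t) ^ 2) <= (/ x) ^ 2 / 2).
    { assert (0 <= t ^ 2 <= (/ x) ^ 2) by (split; [nra | apply pow_incr; lra]).
      assert (1 <= (1 + t) ^ 2) by nra.
      assert (0 < / (1 + t) ^ 2 <= 1)
        by (split; [apply Rinv_0_lt_compat; lra | rewrite <- Rinv_1; apply Rinv_le_contravar; lra]).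
      replace (t ^ 2 / (2 * (1 + t) ^ 2)) with (t ^ 2 / 2 * / (1 + t) ^ 2) by (field; nra).
      nra. }
    replace (/ (2 * x ^ 3)) with ((/ x) ^ 2 / 2 * / x) by (field; lra).
    nra.
Qed.

Lemma gamma_coef_split (a b : R) (n : nat) :
  0 < a * INR n + b ->
  gamma_coef a b n =
  (/ (a * INR n + b) - / (a * INR n + b + 1)) / 2 + trap_err (a * INR n + b).
Proof.
  intros H; unfold gamma_coef, trap_err.
  rewrite ln_div by lra; field; lra.
Qed.

(** * Finite real sums and products, and refinement of the trapezoidal rule *)

Fixpoint rsum (u : nat -> R) (n : nat) : R :=
  match n with
  | O => 0
  | S m => rsum u m + u m
  end.

Lemma rsum_S (u : nat -> R) (n : nat) : rsum u (S n) = rsum u n + u n.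
Proof. reflexivity. Qed.

Lemma sum_n_m_rsum (u : nat -> R) (n : nat) :
  sum_n_m u 1 n = rsum (fun m => u (S m)) n.
Proof.
  induction n as [|n IH].
  - exact (sum_n_m_zero u 1 0 Nat.lt_0_1).
  - rewrite sum_n_Sm by lia; rewrite IH; reflexivity.
Qed.

Lemma prod_f_R0_S_l (f : nat -> R) (n : nat) :
  prod_f_R0 f (S n) = f 0%nat * prod_f_R0 (fun k => f (S k)) n.
Proof.
  induction n as [|n IH]; [reflexivity|].
  change (prod_f_R0 f (S (S n))) with (prod_f_R0 f (S n) * f (S (S n))).
  rewrite IH; simpl; ring.
Qed.

Lemma prod_f_R0_ext (f g : nat -> R) (n : nat) :
  (forall k, f k = g k) -> prod_f_R0 f n = prod_f_R0 g n.
Proof.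
  intros H; induction n as [|n IH]; simpl; [apply H | rewrite IH, H; reflexivity].
Qed.

Lemma prod_f_R0_pos (f : nat -> R) (n : nat) :
  (forall k, 0 < f k) -> 0 < prod_f_R0 f n.
Proof.
  intros H; induction n as [|n IH]; simpl; [apply H|].
  apply Rmult_lt_0_compat; auto.
Qed.

Lemma rsum_scal (c : R) (u : nat -> R) (n : nat) :
  rsum (fun k => c * u k) n = c * rsum u n.
Proof. induction n as [|n IH]; simpl; [ring | rewrite IH; ring]. Qed.

Lemma rsum_ext (u v : nat -> R) (n : nat) :
  (forall k, (k < n)%nat -> u k = v k) -> rsum u n = rsum v n.
Proof.
  induction n as [|n IH]; simpl; intros H; [reflexivity|].
  rewrite IH, H; auto with arith.
Qed.

(* The summand is the error at [X + m] of the linear interpolation of [1/t]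
   between [X] and [X + B]; its sum is thus a difference of trapezoidal sums. *)
Lemma interpolation_sum (B X : R) (n : nat) :
  0 < X -> 0 < B ->
  rsum (fun m => INR (S m) * (B - INR (S m)) / (X + INR (S m)) / (X * (X + B))) n
  + rsum (fun m => trap_err (X + INR m)) (S n)
  = / (2 * X) + / (2 * (X + INR n + 1))
    + (INR n * B - INR n * (INR n + 1) / 2) / (B * X)
    + INR n * (INR n + 1) / 2 / (B * (X + B)) - ln (X + INR n + 1) + ln X.
Proof.
  intros HX HB; induction n as [|n IH].
  - simpl; unfold trap_err; rewrite !Rplus_0_r; field; lra.
  - rewrite (rsum_S _ n), (rsum_S _ (S n)).
    pose proof (pos_INR n) as Hn.
    rewrite Rplus_assoc, (Rplus_comm (_ / _ / _)), <- 2!Rplus_assoc, (Rplus_assoc _ (trap_err _)).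
    rewrite IH; unfold trap_err; rewrite !S_INR.
    replace (X + INR n + 1) with (X + (INR n + 1)) by ring.
    field; lra.
Qed.

(** The product in [P] cancels against the inner factors of [Q], which leaves the sum of linear
    interpolation errors between [X = B k] and [X + B]. The logarithms then match because [ln (B
    (k+1)) - ln (B k) = ln (k+1) - ln k]. *)
Lemma P_over_Q (B k : nat) :
  (1 < B)%nat -> (0 < k)%nat ->
  P B (INR k) / Q B (INR k) =
  trap_err (INR k) - rsum (fun m => trap_err (INR (B * k + m))) B.
Proof.
  intros HB Hk.
  assert (Hk' : 1 <= INR k) by (apply (le_INR 1); lia).
  assert (HB' : 2 <= INR B) by (apply (le_INR 2); lia).
  set (X := INR B * INR k); assert (HX : 0 < X) by (unfold X; nra).
  assert (E : P B (INR k) / Q B (INR k) =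
     rsum (fun m => INR (S m) * (INR B - INR (S m)) / (X + INR (S m)) / (X * (X + INR B))) (B - 1)).
  { unfold P, Q; fold X; rewrite sum_n_m_rsum.
    (* [prod_f_R0 f n] has [n + 1] factors, so [Q] splits into its two outer factors and the [B - 1]
       inner ones that also occur in [P]. *)
    replace (prod_f_R0 (fun j => X + INR j) B) with
      (X * prod_f_R0 (fun j => X + INR (j + 1)) (B - 2) * (X + INR B)).
    2:{ replace B with (S (S (B - 2))) at 2 3 by lia.
        change (prod_f_R0 (fun j => X + INR j) (S (S (B - 2)))) with
          (prod_f_R0 (fun j => X + INR j) (S (B - 2)) * (X + INR (S (S (B - 2))))).
        rewrite prod_f_R0_S_l; f_equal; f_equal; [symmetry; apply Rplus_0_r|].
        apply prod_f_R0_ext; intros j; rewrite Nat.add_1_r; reflexivity. }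
    assert (Hp : 0 < prod_f_R0 (fun j => X + INR (j + 1)) (B - 2))
      by (apply prod_f_R0_pos; intros j; pose proof (pos_INR (j + 1)); lra).
    symmetry; rewrite (rsum_ext _ (fun m => / (X * (X + INR B)) *
               (INR (S m) * (INR B - INR (S m)) / (X + INR (S m))))).
    2:{ intros m _; unfold Rdiv; ring. }
    rewrite rsum_scal; field; lra. }
  pose proof (interpolation_sum (INR B) X (B - 1) HX ltac:(lra)) as I.
  rewrite <- E in I.
  replace (S (B - 1)) with B in I by lia.
  rewrite (rsum_ext (fun m => trap_err (INR (B * k + m))) (fun m => trap_err (X + INR m)))
    by (intros m _; unfold X; rewrite plus_INR, mult_INR; reflexivity).
  rewrite (minus_INR B 1) in I by lia; change (INR 1) with 1 in I.
  replace (X + (INR B - 1) + 1) with (INR B * (INR k + 1)) in I by (unfold X; ring).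
  change (ln X) with (ln (INR B * INR k)) in I; rewrite !ln_mult in I by lra.
  (* The contributions [1/(2X)] and [(B-1)/(2X)] add up to [1/(2k)], and likewise at the right
     endpoint to [1/(2(k+1))]. *)
  match type of I with _ = ?T => replace T with (trap_err (INR k)) in I end; [lra|].
  unfold trap_err, X; field; nra.
Qed.

(** * Complex power series *)

Lemma sum_n_rsum (u : nat -> R) (n : nat) : sum_n u n = rsum u (S n).
Proof.
  induction n as [|n IH].
  - rewrite sum_O; simpl; ring.
  - rewrite sum_Sn, IH; reflexivity.
Qed.

Lemma is_series_rsum (u : nat -> R) (l : R) :
  is_series u l <-> is_lim_seq (rsum u) l.
Proof.
  rewrite (is_lim_seq_incr_1 (rsum u)).
  change (is_series u l) with (is_lim_seq (sum_n u) l).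
  split; apply is_lim_seq_ext; intros n; rewrite sum_n_rsum; reflexivity.
Qed.

(** Stated for an additive [f] bounded by the modulus so as to cover the real and the imaginary part
    at once. *)
Lemma Cseries_component (f : C -> R) (u : nat -> C) (l : C) :
  (forall x y : C, f (x + y)%C = f x + f y) -> (forall x, Rabs (f x) <= Cmod x) ->
  is_Cseries u l -> is_series (fun n => f (u n)) (f l).
Proof.
  intros Hf Hb Hu; apply is_series_psum in Hu; apply is_series_rsum.
  assert (H0 : f 0 = 0) by (pose proof (Hf 0 0) as H; rewrite Cplus_0_l in H; lra).
  assert (E : forall n, f (psum u n) = rsum (fun n => f (u n)) n).
  { induction n as [|n IH]; simpl; [exact H0 | rewrite Hf, IH; reflexivity]. }
  replace (Finite (f l)) with (Finite (f l + 0)) by (f_equal; ring).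
  apply is_lim_seq_ext with (fun n => f l + (rsum (fun n => f (u n)) n - f l)); [intros; ring|].
  apply is_lim_seq_plus'; [apply is_lim_seq_const|].
  apply is_lim_seq_abs_0, is_lim_seq_squeeze0 with (2 := Hu).
  intros n; split; [apply Rabs_pos|].
  eapply Rle_trans; [|apply Hb]; apply Req_le; f_equal.
  pose proof (Hf (psum u n - l)%C l) as E'; rewrite <- E.
  replace (psum u n - l + l)%C with (psum u n) in E' by ring; lra.
Qed.

Lemma im_le_Cmod (x : C) : Rabs (Im x) <= Cmod x.
Proof.
  eapply Rle_trans; [apply Rmax_r | apply Rmax_Cmod].
Qed.

Lemma power_series_unique_R (u v : nat -> R) :
  (forall x, Rabs x < 1 -> exists L,
     is_series (fun k => u k * x ^ k) L /\ is_series (fun k => v k * x ^ k) L) ->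
  forall n, u n = v n.
Proof.
  intros H n.
  assert (R0 : forall w : nat -> R,
    (forall x, Rabs x < 1 -> ex_series (fun k => w k * x ^ k)) -> Rbar_lt 0 (CV_radius w)).
  { intros w Hw; apply Rbar_lt_le_trans with (Rabs (1 / 2)).
    - simpl; rewrite Rabs_pos_eq; lra.
    - apply Rbar_not_lt_le; intros Hlt; apply CV_disk_outside in Hlt; apply Hlt.
      apply ex_series_lim_0, Hw; rewrite Rabs_pos_eq; lra. }
  apply PSeries_ext_recip.
  - apply R0; intros x Hx; destruct (H x Hx) as [L [H1 _]]; exists L; exact H1.
  - apply R0; intros x Hx; destruct (H x Hx) as [L [_ H1]]; exists L; exact H1.
  - exists (mkposreal 1 Rlt_0_1); intros x Hx.
    assert (Hx' : Rabs x < 1).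
    { change (Rabs (x - 0) < 1) in Hx; rewrite Rminus_0_r in Hx; exact Hx. }
    destruct (H x Hx') as [L [H1 H2]].
    unfold PSeries; rewrite (is_series_unique _ _ H1), (is_series_unique _ _ H2); reflexivity.
Qed.

(** Real arguments suffice: for real [x] the real and imaginary parts of the series are real power
    series in [x]. *)
Lemma power_series_unique (u v : nat -> C) :
  (forall x : R, Rabs x < 1 -> exists L,
     is_Cseries (fun k => u k * Cpow (RtoC x) k)%C L /\
     is_Cseries (fun k => v k * Cpow (RtoC x) k)%C L) ->
  forall n, u n = v n.
Proof.
  intros H n.
  assert (F : forall f : C -> R, (forall x y : C, f (x + y)%C = f x + f y) ->
    (forall x, Rabs (f x) <= Cmod x) -> (forall (x : C) (y : R), f (x * y)%C = f x * y) ->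
    f (u n) = f (v n)).
  { intros f Hp Hb Hs; apply (power_series_unique_R (fun k => f (u k)) (fun k => f (v k))).
    intros x Hx; destruct (H x Hx) as [L [H1 H2]]; exists (f L).
    split.
    - apply is_series_ext with (fun k => f (u k * Cpow (RtoC x) k)%C);
        [intros k; rewrite <- RtoC_pow; apply Hs | apply Cseries_component; assumption].
    - apply is_series_ext with (fun k => f (v k * Cpow (RtoC x) k)%C);
        [intros k; rewrite <- RtoC_pow; apply Hs | apply Cseries_component; assumption]. }
  apply injective_projections.
  - apply (F Re); [reflexivity | apply re_le_Cmod | intros; unfold Re, Im; simpl; ring].
  - apply (F Im); [reflexivity | apply im_le_Cmod | intros; unfold Re, Im; simpl; ring].
Qed.

(** These are the terms of a series that converges by the ratio test, with ratios [q + q/(n+1)]. The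
    case [q = 0] is separate because the test needs nonzero terms. *)
Lemma is_lim_seq_n_geom (q : R) :
  0 <= q < 1 -> is_lim_seq (fun n => INR (n + 1) * q ^ n) 0.
Proof.
  intros Hq; destruct (Req_dec q 0) as [->|Hq0].
  - apply is_lim_seq_incr_1, is_lim_seq_ext with (fun _ => 0); [|apply is_lim_seq_const].
    intros n; simpl; ring.
  - apply is_lim_seq_abs_0, ex_series_lim_0, ex_series_DAlembert with q; [apply Hq| |].
    + intros n; pose proof (pos_INR n); rewrite plus_INR; simpl.
      apply Rmult_integral_contrapositive_currified; [lra | apply pow_nonzero, Hq0].
    + apply is_lim_seq_ext with (fun n => q + q * / INR (S n)).
      * intros n; pose proof (pos_INR n).
        replace (S n + 1)%nat with (S (S n)) by lia; replace (n + 1)%nat with (S n) by lia.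
        rewrite !S_INR; simpl pow.
        assert (q ^ n <> 0) by apply pow_nonzero, Hq0.
        replace (_ / _) with (q + q * / (INR n + 1)) by (field; lra).
        assert (0 < / (INR n + 1)) by (apply Rinv_0_lt_compat; lra).
        rewrite Rabs_pos_eq; [reflexivity | nra].
      * replace (Finite q) with (Finite (q + q * 0)) by (f_equal; ring).
        apply is_lim_seq_plus'; [apply is_lim_seq_const|].
        apply is_lim_seq_mult'; [apply is_lim_seq_const | apply is_lim_seq_inv_S].
Qed.

(** For [l] equal to 0 or 1, the coefficient of [y^n] in [1 / (1 - z y)^(l+1)]; for [l = 1] it is
    also the derivative of [z^(n+1)]. *)
Definition weight (l : nat) (z : C) (n : nat) : C := (RtoC (INR (n + 1) ^ l) * Cpow z n)%C.

Lemma one_minus_neq0 (y : C) : Cmod y < 1 -> (1 - y)%C <> 0.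
Proof.
  intros Hy E.
  assert (y = 1) as -> by (replace y with (1 - (1 - y))%C by ring; rewrite E; ring).
  rewrite Cmod_1 in Hy; lra.
Qed.

Lemma INR_n1 (n : nat) : RtoC (INR (n + 1)) = (RtoC (INR n) + 1)%C.
Proof. rewrite plus_INR, RtoC_plus; reflexivity. Qed.

Lemma geometric_series (l : nat) (y : C) :
  l = 0%nat \/ l = 1%nat -> Cmod y < 1 ->
  is_Cseries (weight l y) (1 / Cpow (1 - y) (l + 1))%C.
Proof.
  intros Hl Hy; pose proof (one_minus_neq0 y Hy) as Hn.
  assert (Hd : 0 < Cmod (1 - y)) by (apply Cmod_gt_0, Hn).
  assert (Hq : 0 <= Cmod y < 1) by (split; [apply Cmod_ge_0 | exact Hy]).
  apply is_series_psum.
  (* One majorant for both values of [l]: the remainders, computed exactly below, are at most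
     [|y|^n / |1-y|] and [2 (n+1) |y|^n / |1-y|^2]. *)
  apply is_lim_seq_squeeze0 with
    (fun n => (INR (n + 1) * Cmod y ^ n) * (/ Cmod (1 - y) + 2 / Cmod (1 - y) ^ 2)).
  2:{ replace (Finite 0) with (Finite (0 * (/ Cmod (1 - y) + 2 / Cmod (1 - y) ^ 2)))
        by (f_equal; ring).
      apply is_lim_seq_mult'; [apply is_lim_seq_n_geom, Hq | apply is_lim_seq_const]. }
  intros n; split; [apply Cmod_ge_0|].
  assert (Hp : 0 <= Cmod y ^ n) by (apply pow_le, Cmod_ge_0).
  assert (Hi : 0 < / Cmod (1 - y)) by (apply Rinv_0_lt_compat, Hd).
  assert (Hi2 : 0 < / Cmod (1 - y) ^ 2) by (apply Rinv_0_lt_compat, pow_lt, Hd).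
  pose proof (pos_INR n) as Hnn.
  assert (HN : INR (n + 1) = INR n + 1) by (rewrite plus_INR; reflexivity).
  assert (Hm : 0 <= (INR n + 1) * Cmod y ^ n) by nra.
  destruct Hl as [-> | ->].
  - assert (E : (psum (weight 0 y) n - 1 / Cpow (1 - y) (0 + 1) = - Cpow y n / (1 - y))%C).
    { simpl; clear - Hn; induction n as [|n IH]; simpl.
      - field; exact Hn.
      - replace (_ + weight 0 y n - _)%C with ((psum (weight 0 y) n - 1 / ((1 - y) * 1)) + weight 0 y n)%C by ring.
        rewrite IH; unfold weight; simpl; field; exact Hn. }
    rewrite E, Cmod_div, Cmod_opp, Cmod_pow, HN by exact Hn.
    unfold Rdiv; rewrite Rmult_plus_distr_l.
    assert (0 <= (INR n + 1) * Cmod y ^ n * / Cmod (1 - y) ^ 2) by (apply Rmult_le_pos; lra).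
    apply Rle_trans with ((INR n + 1) * Cmod y ^ n * / Cmod (1 - y)); [|lra].
    apply Rmult_le_compat_r; nra.
  - assert (E : (psum (weight 1 y) n - 1 / Cpow (1 - y) (1 + 1) =
                 (- RtoC (INR (n + 1)) * Cpow y n + RtoC (INR n) * (y * Cpow y n)) / (1 - y) ^ 2)%C).
    { clear - Hn; induction n as [|n IH].
      - simpl; field; exact Hn.
      - change (psum (weight 1 y) (S n)) with (psum (weight 1 y) n + weight 1 y n)%C.
        replace (_ + weight 1 y n - _)%C with ((psum (weight 1 y) n - 1 / (1 - y) ^ (1 + 1)) + weight 1 y n)%C by ring.
        rewrite IH; unfold weight; rewrite pow_1, !INR_n1, S_INR, RtoC_plus.
        rewrite (Cpow_S y n); simpl Cpow; field; exact Hn. }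
    rewrite E, Cmod_div, Cmod_pow, HN by (apply Cpow_nz, Hn).
    eapply Rle_trans with ((INR n + 1) * Cmod y ^ n * 2 * / Cmod (1 - y) ^ 2); 
      [|rewrite Rmult_plus_distr_l; unfold Rdiv;
        assert (0 <= (INR n + 1) * Cmod y ^ n * / Cmod (1 - y)) by (apply Rmult_le_pos; lra); lra].
    unfold Rdiv; apply Rmult_le_compat_r; [lra|].
    eapply Rle_trans; [apply Cmod_triangle|].
    rewrite !Cmod_mult, Cmod_opp, !Cmod_R, Cmod_pow, !Rabs_pos_eq by lra.
    nra.
Qed.

(** * The coefficients of the generating function *)

Lemma pow_n_Cpow (x : C) (k : nat) : pow_n (K := C_Ring) x k = Cpow x k.
Proof. induction k as [|k IH]; simpl; [|rewrite IH]; reflexivity. Qed.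

Lemma is_pseries_Cseries (c : nat -> C) (x L : C) :
  is_pseries (K := C_AbsRing) (V := C_NormedModule) c x L <->
  is_Cseries (fun k => c k * Cpow x k)%C L.
Proof.
  unfold is_pseries; split; apply is_series_ext; intros k;
    rewrite <- pow_n_Cpow; exact (Cmult_comm _ _).
Qed.

(** Coefficients of [(1 - x)] times the power series of [c]. *)
Definition backward_diff (c : nat -> C) (k : nat) : C :=
  match k with
  | O => c O
  | S j => (c k - c j)%C
  end.

Lemma psum_backward_diff (c : nat -> C) (k : nat) : psum (backward_diff c) (S k) = c k.
Proof.
  induction k as [|k IH]; [simpl; ring|].
  change (psum (backward_diff c) (S k) + (c (S k) - c k) = c (S k))%C.
  rewrite IH; ring.
Qed.

Lemma Cseries_backward_diff (c : nat -> C) (x L : C) :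
  is_Cseries (fun k => c k * Cpow x k)%C L ->
  is_Cseries (fun k => backward_diff c k * Cpow x k)%C ((1 - x) * L)%C.
Proof.
  intros H.
  apply Cseries_ext with
    (fun k => c k * Cpow x k - match k with O => 0 | S j => x * (c j * Cpow x j) end)%C.
  { intros [|k]; simpl; ring. }
  replace ((1 - x) * L)%C with (L - x * L)%C by ring.
  apply Cseries_minus; [exact H|].
  apply Cseries_shift; replace (x * L - 0)%C with (x * L)%C by ring.
  apply Cseries_scal, H.
Qed.

Lemma weight_bound (l : nat) (z : C) (n : nat) :
  l = 0%nat \/ l = 1%nat -> Cmod z <= 1 -> Cmod (weight l z n) <= INR (n + 1).
Proof.
  intros Hl Hz; unfold weight.
  rewrite Cmod_mult, Cmod_R, Cmod_pow.
  assert (0 <= Cmod z ^ n <= 1).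
  { split; [apply pow_le, Cmod_ge_0|].
    rewrite <- (pow1 n); apply pow_incr; split; [apply Cmod_ge_0 | exact Hz]. }
  assert (1 <= INR (n + 1)) by (apply (le_INR 1); lia).
  rewrite Rabs_pos_eq by (apply pow_le; lra).
  destruct Hl as [-> | ->]; simpl; nra.
Qed.

(** Let [F x] be the sum of the [gen_term]s. The term of index [n] at [x^B] is the term of index
    [n + 1] at [x], so [F x] is its first term plus [F (x^B)]. Comparing coefficients gives a
    relation for the backward differences of [c], and summing it gives the one for [c]. *)
Lemma gen_coef_rec (a b B l : nat) (z : C) (c : nat -> C) :
  (0 < a)%nat -> (0 < b)%nat -> (1 < B)%nat -> Cmod z <= 1 -> l = 0%nat \/ l = 1%nat ->
  is_gen_coef a b B l z c ->
  forall k, c k = (spread a (b + a * l) (weight l z) k + c (k / B)%nat)%C.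
Proof.
  intros Ha Hb HB Hz Hl Hc k.
  set (N0 := (b + a * l)%nat).
  set (s := backward_diff c).
  assert (R : forall k, s k = (spread a N0 (weight l z) k - spread a (S N0) (weight l z) k
                               + spread B 0 s k)%C).
  { apply power_series_unique; intros x Hx.
    set (X := RtoC x).
    assert (HX : Cmod X < 1) by (unfold X; rewrite Cmod_R; exact Hx).
    assert (HXn : forall n, (0 < n)%nat -> Cmod (Cpow X n) < 1).
    { intros n Hn; rewrite Cmod_pow; apply pow_lt_1_compat; [|exact Hn].
      split; [apply Cmod_ge_0 | exact HX]. }
    assert (HB' := HXn B ltac:(lia)).
    assert (D : forall y : C, Cmod y < 1 -> exists L : C,
      is_Cseries (gen_term a b B l z y) L /\
      is_Cseries (fun k => s k * Cpow y k)%C L).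
    { intros y Hy; destruct (Hc y Hy) as [L [H1 H2]]; exists L; split; [exact H1|].
      apply is_pseries_Cseries, Cseries_backward_diff in H2.
      replace ((1 - y) * (1 / (1 - y) * L))%C with L in H2; [exact H2|].
      field; apply one_minus_neq0, Hy. }
    destruct (D X HX) as [L [S1 S2]], (D _ HB') as [L' [S1' S2']].
    exists L; split; [exact S2|].
    assert (E : L = (gen_term a b B l z X 0 + L')%C).
    { apply Cseries_shift in S1.
      assert (L - gen_term a b B l z X 0 = L')%C as <-; [|ring].
      apply (Cseries_unique _ _ _ S1).
      apply Cseries_ext with (2 := S1'); intros n; unfold gen_term.
      rewrite <- !Cpow_mult_r, !Nat.pow_succ_r'.
      replace (B * ((b + a * l) * B ^ n))%nat with ((b + a * l) * (B * B ^ n))%nat by ring.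
      replace (B * (a * B ^ n))%nat with (a * (B * B ^ n))%nat by ring.
      reflexivity. }
    assert (Hg : is_Cseries (weight l (z * Cpow X a)%C) (1 / Cpow (1 - z * Cpow X a) (l + 1))%C).
    { apply geometric_series; [exact Hl|].
      rewrite Cmod_mult; specialize (HXn a Ha).
      pose proof (Cmod_ge_0 (Cpow X a)); pose proof (Cmod_ge_0 z); nra. }
    assert (Hw : forall N, is_Cseries (fun k => spread a N (weight l z) k * Cpow X k)%C
                   (Cpow X N * (1 / Cpow (1 - z * Cpow X a) (l + 1)))%C).
    { intros N; apply Cseries_ext with (spread a N (fun n => weight l z n * Cpow X (a * n + N)%nat)%C).
      - intros n; apply (spread_mult a N (weight l z) (Cpow X)), Ha.
      - apply Cseries_spread; [exact Ha|].
        apply Cseries_ext with (2 := Cseries_scal (Cpow X N) _ _ Hg).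
        intros n; unfold weight; rewrite Cpow_mult_l, Cpow_add_r, <- Cpow_mult_r; ring. }
    apply Cseries_ext with (fun k => (spread a N0 (weight l z) k * Cpow X k
        - spread a (S N0) (weight l z) k * Cpow X k) + spread B 0 s k * Cpow X k)%C.
    { intros n; ring. }
    rewrite E; apply Cseries_plus.
    (* The factor [1 - x] of the first term splits it into two spreads of the same weights, with
       offsets [N0] and [N0 + 1]. *)
    - replace (gen_term a b B l z X 0) with
        (Cpow X N0 * (1 / Cpow (1 - z * Cpow X a) (l + 1)) -
         Cpow X (S N0) * (1 / Cpow (1 - z * Cpow X a) (l + 1)))%C.
      + apply Cseries_minus; apply Hw.
      + unfold gen_term, N0; rewrite Nat.pow_0_r, !Nat.mul_1_r, Cpow_1_r, Cpow_S.
        unfold Cdiv; ring.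
    - apply Cseries_ext with (spread B 0 (fun n => s n * Cpow X (B * n + 0)%nat)%C).
      + intros n; apply (spread_mult B 0 s (Cpow X)); lia.
      + apply Cseries_spread; [lia|].
        apply Cseries_ext with (2 := S2').
        intros n; rewrite Nat.add_0_r, Cpow_mult_r; reflexivity. }
  (* The two spreads differ by a shift of one index, so their difference telescopes to a single
     value. *)
  assert (T : forall n, psum s n =
     (match n with O => 0 | S j => spread a N0 (weight l z) j end + psum (spread B 0 s) n)%C).
  { induction n as [|n IH]; [simpl; ring|].
    change (psum s (S n)) with (psum s n + s n)%C.
    change (psum (spread B 0 s) (S n)) with (psum (spread B 0 s) n + spread B 0 s n)%C.
    rewrite IH, R.
    replace (match n with O => RtoC 0 | S j => spread a N0 (weight l z) j end)%C
      with (spread a (S N0) (weight l z) n) by (destruct n; reflexivity).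
    ring. }
  specialize (T (S k)); unfold s at 1 in T.
  rewrite psum_backward_diff, psum_spread in T by lia.
  rewrite T; f_equal.
  (* The multiples of [B] in [0..k] number [k / B + 1], and that many differences sum to
     [c (k / B)]. *)
  replace ((S k - 0 + (B - 1)) / B)%nat with (S (k / B)).
  - apply psum_backward_diff.
  - replace (S k - 0 + (B - 1))%nat with (k + 1 * B)%nat by lia.
    rewrite Nat.div_add by lia; lia.
Qed.

(** The recurrence leaves [c 0] undetermined, since [0 / B = 0]. Its value is read off at [x = 0],
    where every [gen_term] vanishes because its exponent is positive. *)
Lemma gen_coef_0 (a b B l : nat) (z : C) (c : nat -> C) :
  (0 < b)%nat -> (1 < B)%nat -> is_gen_coef a b B l z c -> c 0%nat = RtoC 0.
Proof.
  intros Hb HB Hc.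
  destruct (Hc (RtoC 0)) as [T [H1 H2]]; [rewrite Cmod_0; lra|].
  assert (P0 : forall n, (0 < n)%nat -> Cpow (RtoC 0) n = RtoC 0).
  { intros [|n] Hn; [lia|]; simpl; ring. }
  assert (Z : forall (u : nat -> C) n, (forall k, u (S k) = RtoC 0) -> psum u (S n) = u 0%nat).
  { intros u n Hu; induction n as [|n IH]; [simpl; ring|].
    change (psum u (S n) + u (S n) = u 0%nat)%C; rewrite IH, Hu; ring. }
  assert (U : forall (u : nat -> C) L, (forall k, u (S k) = RtoC 0) -> is_Cseries u L -> L = u 0%nat).
  { intros u L Hu HL; apply (Cseries_unique _ _ _ HL).
    apply is_series_psum, is_lim_seq_incr_1.
    apply is_lim_seq_ext with (fun _ => 0); [|apply is_lim_seq_const].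
    intros n; rewrite Z by exact Hu.
    replace (_ - _)%C with (RtoC 0) by ring; rewrite Cmod_0; reflexivity. }
  assert (G : forall k, gen_term a b B l z 0 k = RtoC 0).
  { intros k; unfold gen_term.
    rewrite (P0 ((b + a * l) * B ^ k)%nat); [unfold Cdiv; ring|].
    assert (0 < B ^ k)%nat by (apply Nat.neq_0_lt_0, Nat.pow_nonzero; lia); nia. }
  apply U in H1; [|intros; apply G]; rewrite G in H1; subst T.
  apply is_pseries_Cseries, U in H2.
  - simpl in H2; rewrite Cmult_1_r in H2; rewrite <- H2; ring.
  - intros k; rewrite P0 by lia; ring.
Qed.

(** * Summation by parts *)

Lemma psum_plus (u v : nat -> C) (n : nat) :
  psum (fun k => u k + v k)%C n = (psum u n + psum v n)%C.
Proof. induction n as [|n IH]; simpl; [|rewrite IH]; ring. Qed.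

(** [c (k / B)] is constant on each block of [B] consecutive indices starting at a multiple of
    [B]. *)
Lemma psum_blocks (c : nat -> C) (h : nat -> R) (B M : nat) :
  (0 < B)%nat ->
  psum (fun k => c (k / B)%nat * RtoC (h k))%C (B * M) =
  psum (fun k => c k * RtoC (rsum (fun m => h (B * k + m)%nat) B))%C M.
Proof.
  intros HB; induction M as [|M IH]; [rewrite Nat.mul_0_r; reflexivity|].
  replace (B * S M)%nat with (B * M + B)%nat by lia.
  assert (H : forall n, (n <= B)%nat ->
    psum (fun k => c (k / B)%nat * RtoC (h k))%C (B * M + n) =
    (psum (fun k => c (k / B)%nat * RtoC (h k)) (B * M) +
     c M * RtoC (rsum (fun m => h (B * M + m)%nat) n))%C).
  { induction n as [|n IHn]; intros Hn; [rewrite Nat.add_0_r; simpl; ring|].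
    rewrite Nat.add_succ_r; simpl; rewrite IHn, RtoC_plus by lia.
    rewrite <- (Nat.div_unique (B * M + n) B M n) by lia; ring. }
  rewrite H, IH by lia; reflexivity.
Qed.

Lemma spread_bound (a N0 : nat) (w : nat -> C) (k : nat) :
  (0 < a)%nat -> (0 < N0)%nat -> (forall n, Cmod (w n) <= INR (n + 1)) ->
  Cmod (spread a N0 w k) <= INR k.
Proof.
  intros Ha HN Hw; unfold spread.
  destruct (Nat.leb_spec N0 k) as [H|H]; [|rewrite Cmod_0; apply pos_INR].
  destruct (_ =? _)%nat; [|rewrite Cmod_0; apply pos_INR].
  eapply Rle_trans; [apply Hw|]; apply le_INR.
  assert ((k - N0) / a <= k - N0)%nat by (apply Nat.Div0.div_le_upper_bound; nia); lia.
Qed.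

(** Since [k / B <= k / 2], the recurrence gives [|c k| <= k + 2 (k/2)]. Linear growth is enough
    against the cubic decay of [trap_err]. *)
Lemma coef_bound (B : nat) (e c : nat -> C) :
  (1 < B)%nat -> (forall k, Cmod (e k) <= INR k) -> c 0%nat = RtoC 0 ->
  (forall k, c k = (e k + c (k / B)%nat)%C) ->
  forall k, Cmod (c k) <= 2 * INR k.
Proof.
  intros HB He H0 Hc k; induction k as [k IH] using lt_wf_ind.
  destruct (Nat.eq_dec k 0) as [->|Hk]; [rewrite H0, Cmod_0; simpl; lra|].
  rewrite Hc; eapply Rle_trans; [apply Cmod_triangle|].
  specialize (IH (k / B)%nat ltac:(apply Nat.div_lt; lia)); specialize (He k).
  assert (2 * (k / B) <= k)%nat as H2 by (pose proof (Nat.div_mod_eq k B); nia).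
  apply le_INR in H2; rewrite mult_INR in H2; simpl INR in H2; lra.
Qed.

(* Summation by parts: as [P B k / Q B k = h k - sum_(m < B) h (B k + m)] for
   [h = trap_err], the partial sum of [c k * (P B k / Q B k)] up to [M] equals
   that of [e k * h k] up to [B M], up to a difference of two partial sums of
   the convergent series [c k * h k]. *)
Lemma coef_series (B : nat) (e c : nat -> C) (S : C) :
  (1 < B)%nat -> (forall k, Cmod (e k) <= INR k) -> c 0%nat = RtoC 0 ->
  (forall k, c k = (e k + c (k / B)%nat)%C) ->
  is_Cseries (fun k => e k * RtoC (trap_err (INR k)))%C S ->
  is_Cseries (fun k => c (k + 1)%nat *
     RtoC (P B (INR (k + 1)) / Q B (INR (k + 1))))%C S.
Proof.
  intros HB He H0 Hc HS.
  set (p := fun k => (c k * RtoC (trap_err (INR k)))%C).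
  (* The terms are at most [2k / (2k^3) = 1/k^2], hence at most [2 / (k (k+1))]. *)
  assert (Hp : exists L : C, is_Cseries p L).
  { destruct (Cseries_exists (fun k => p (k + 1)%nat) 2) as [L HL].
    - intros k; unfold p; rewrite Cmod_mult, Cmod_R.
      replace (k + 2)%nat with (k + 1 + 1)%nat by lia; rewrite (plus_INR (k + 1) 1).
      change (INR 1) with 1.
      assert (Hk : 1 <= INR (k + 1)) by (apply (le_INR 1); lia).
      pose proof (coef_bound B e c HB He H0 Hc (k + 1)) as Hck.
      set (t := INR (k + 1)) in *.
      pose proof (trap_err_bound t ltac:(lra)) as Ht.
      rewrite Rabs_pos_eq by lra.
      apply Rle_trans with (2 * t * / (2 * t ^ 3)).
      { apply Rmult_le_compat; [apply Cmod_ge_0 | lra | exact Hck | lra]. }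
      replace (2 * t * / (2 * t ^ 3)) with (2 * / (t * (2 * t))) by (field; lra).
      apply Rmult_le_compat_l; [lra|]; apply Rinv_le_contravar; nra.
    - exists L; apply Cseries_shift.
      replace (L - p 0%nat)%C with L by (unfold p; rewrite H0; ring).
      apply Cseries_ext with (2 := HL); intros n; rewrite Nat.add_1_r; reflexivity. }
  destruct Hp as [L HL].
  (* This is [c k] times [P / Q] for positive [k]; the term at 0 vanishes with [c 0] and is shifted
     away at the end. *)
  set (v := fun k => (c k * RtoC (trap_err (INR k) - rsum (fun m => trap_err (INR (B * k + m))) B))%C).
  assert (Hv : is_Cseries v S).
  { apply is_series_psum in HL.
    assert (Hphi : filterlim (fun M => (B * M)%nat) eventually eventually).
    { intros Pr [N HN]; exists N; intros n Hn; apply HN; nia. }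
    apply (Cseries_psum_compare _ v S (fun M => (B * M)%nat)
      (fun M => Cmod (psum p M - L) + Cmod (psum p (B * M) - L)) HS Hphi).
    - replace (Finite 0) with (Finite (0 + 0)) by (f_equal; ring).
      apply is_lim_seq_plus'; [exact HL|].
      exact (filterlim_comp _ _ _ (fun M => (B * M)%nat) _ _ _ _ Hphi HL).
    - intros M.
      assert (E1 : psum p M = (psum v M +
        psum (fun k => c (k / B)%nat * RtoC (trap_err (INR k))) (B * M))%C).
      { rewrite (psum_blocks c (fun k => trap_err (INR k))) by lia.
        rewrite <- psum_plus; apply psum_ext; intros k _.
        unfold p, v; rewrite RtoC_minus; ring. }
      assert (E2 : psum p (B * M) = (psum (fun k => e k * RtoC (trap_err (INR k))) (B * M) +
        psum (fun k => c (k / B)%nat * RtoC (trap_err (INR k))) (B * M))%C).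
      { rewrite <- psum_plus; apply psum_ext; intros k _.
        unfold p; rewrite (Hc k) at 1; ring. }
      match goal with |- Cmod ?x <= _ =>
        replace x with ((psum p M - L) + - (psum p (B * M) - L))%C
          by (rewrite E1, E2; ring) end.
      rewrite <- (Cmod_opp (psum p (B * M) - L)); apply Cmod_triangle. }
  apply Cseries_shift in Hv.
  replace (S - v 0%nat)%C with S in Hv by (unfold v; rewrite H0; ring).
  apply Cseries_ext with (2 := Hv); intros k; unfold v.
  rewrite Nat.add_1_r, P_over_Q by lia; reflexivity.
Qed.

(** * The integrals *)

Local Notation is_CRInt := (is_RInt (V := C_R_NormedModule)).

Lemma CRInt_pair (f : R -> C) (u v : R) (I : C) :
  is_CRInt f u v I <->
  is_RInt (fun x => Re (f x)) u v (Re I) /\ is_RInt (fun x => Im (f x)) u v (Im I).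
Proof.
  split.
  - intros H; split.
    + apply (is_RInt_fct_extend_fst (U := R_NormedModule) (V := R_NormedModule) _ _ _ _ H).
    + apply (is_RInt_fct_extend_snd (U := R_NormedModule) (V := R_NormedModule) _ _ _ _ H).
  - intros [H1 H2]; rewrite (surjective_pairing I).
    apply (is_RInt_fct_extend_pair (U := R_NormedModule) (V := R_NormedModule)); assumption.
Qed.

Lemma CRInt_plus (f g : R -> C) (u v : R) (I J : C) :
  is_CRInt f u v I -> is_CRInt g u v J -> is_CRInt (fun x => f x + g x)%C u v (I + J)%C.
Proof. apply (is_RInt_plus (V := C_R_NormedModule)). Qed.

Lemma CRInt_minus (f g : R -> C) (u v : R) (I J : C) :
  is_CRInt f u v I -> is_CRInt g u v J -> is_CRInt (fun x => f x - g x)%C u v (I - J)%C.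
Proof. apply (is_RInt_minus (V := C_R_NormedModule)). Qed.

(** The integral is taken in a real vector space, so a complex factor is handled through the two
    components. *)
Lemma CRInt_scal (w : C) (f : R -> C) (u v : R) (I : C) :
  is_CRInt f u v I -> is_CRInt (fun x => w * f x)%C u v (w * I)%C.
Proof.
  rewrite !CRInt_pair; intros [H1 H2]; split.
  - exact (is_RInt_minus _ _ _ _ _ _ (is_RInt_scal _ _ _ (Re w) _ H1) (is_RInt_scal _ _ _ (Im w) _ H2)).
  - exact (is_RInt_plus _ _ _ _ _ _ (is_RInt_scal _ _ _ (Re w) _ H2) (is_RInt_scal _ _ _ (Im w) _ H1)).
Qed.

Lemma CRInt_RtoC (f : R -> R) (u v I : R) :
  is_RInt f u v I -> is_CRInt (fun x => RtoC (f x)) u v (RtoC I).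
Proof.
  intros H; apply CRInt_pair; split; [exact H|].
  replace (Im (RtoC I)) with (scal (v - u) 0) by apply Rmult_0_r.
  exact (is_RInt_const u v (0 : R_NormedModule)).
Qed.

Lemma CRInt_norm_le (f : R -> C) (g : R -> R) (I : C) (J : R) :
  (forall x, 0 <= x <= 1 -> Cmod (f x) <= g x) ->
  is_CRInt f 0 1 I -> is_RInt g 0 1 J -> Cmod I <= J.
Proof.
  intros H HI HJ; rewrite Cmod_norm.
  apply (norm_RInt_le (V := C_R_NormedModule) f g 0 1 I J); try assumption; [lra|].
  intros x Hx; eapply Rle_trans; [|apply H, Hx].
  apply Req_le; symmetry; exact (Cmod_norm (f x)).
Qed.

Lemma RInt_const_01 (v : R) : is_RInt (fun _ => v) 0 1 v.
Proof.
  pose proof (is_RInt_const (V := R_NormedModule) 0 1 v) as H.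
  change (scal (1 - 0) v) with ((1 - 0) * v) in H.
  rewrite Rminus_0_r, Rmult_1_l in H; exact H.
Qed.

Lemma RInt_pow (n : nat) : is_RInt (fun x => x ^ n) 0 1 (/ INR (S n)).
Proof.
  assert (Hn : INR (S n) <> 0) by (apply not_0_INR; lia).
  replace (/ INR (S n)) with
    (minus ((fun x => x ^ S n / INR (S n)) 1) ((fun x => x ^ S n / INR (S n)) 0)).
  - apply (is_RInt_derive (fun x => x ^ S n / INR (S n)) (fun x => x ^ n)).
    + intros x _; auto_derive; [exact I|]; simpl Nat.pred.
      change (match n with O => 1 | S _ => INR n + 1 end) with (INR (S n)); field; exact Hn.
    + intros x _; apply (ex_derive_continuous (K := R_AbsRing) (V := R_NormedModule)).
      auto_derive; exact I.
  - change (1 ^ S n / INR (S n) - 0 ^ S n / INR (S n) = / INR (S n)).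
    rewrite pow1, pow_i by lia; field; exact Hn.
Qed.

(** Differentiability in a real variable, by components. It is stable under the field operations and
    yields the continuity needed for integrability. *)
Definition smooth (f : R -> C) (x : R) : Prop :=
  ex_derive (fun t => Re (f t)) x /\ ex_derive (fun t => Im (f t)) x.

Lemma smooth_RtoC (f : R -> R) (x : R) : ex_derive f x -> smooth (fun t => RtoC (f t)) x.
Proof. intros H; split; [exact H | exact (ex_derive_const 0 x)]. Qed.

Lemma smooth_const (w : C) (x : R) : smooth (fun _ => w) x.
Proof. split; [exact (ex_derive_const (Re w) x) | exact (ex_derive_const (Im w) x)]. Qed.

Lemma smooth_minus (f g : R -> C) (x : R) :
  smooth f x -> smooth g x -> smooth (fun t => f t - g t)%C x.
Proof.
  intros [H1 H2] [H3 H4]; split.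
  - exact (ex_derive_minus _ _ _ H1 H3).
  - exact (ex_derive_minus _ _ _ H2 H4).
Qed.

Lemma smooth_mult (f g : R -> C) (x : R) :
  smooth f x -> smooth g x -> smooth (fun t => f t * g t)%C x.
Proof.
  intros [H1 H2] [H3 H4]; split.
  - exact (ex_derive_minus _ _ _ (ex_derive_mult _ _ _ H1 H3) (ex_derive_mult _ _ _ H2 H4)).
  - exact (ex_derive_plus _ _ _ (ex_derive_mult _ _ _ H1 H4) (ex_derive_mult _ _ _ H2 H3)).
Qed.

Lemma smooth_inv (f : R -> C) (x : R) :
  smooth f x -> f x <> RtoC 0 -> smooth (fun t => / f t)%C x.
Proof.
  intros [H1 H2] Hf.
  assert (Hd : ex_derive (fun t => fst (f t) ^ 2 + snd (f t) ^ 2) x).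
  { apply (ex_derive_plus (fun t => fst (f t) ^ 2) (fun t => snd (f t) ^ 2));
      apply ex_derive_pow; assumption. }
  assert (Hn : fst (f x) ^ 2 + snd (f x) ^ 2 <> 0).
  { intros E; apply Hf, injective_projections; simpl; nra. }
  split.
  - apply (ex_derive_div (fun t => fst (f t))); assumption.
  - apply (ex_derive_div (fun t => - snd (f t))); [|assumption|exact Hn].
    exact (ex_derive_opp _ _ H2).
Qed.

Lemma smooth_Cpow (f : R -> C) (n : nat) (x : R) :
  smooth f x -> smooth (fun t => Cpow (f t) n) x.
Proof.
  intros H; induction n as [|n IH]; simpl; [apply smooth_const | apply smooth_mult; assumption].
Qed.

Lemma smooth_RInt (f : R -> C) :
  (forall x, 0 <= x <= 1 -> smooth f x) -> exists I : C, is_CRInt f 0 1 I.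
Proof.
  intros H.
  destruct (ex_RInt_continuous (V := R_CompleteNormedModule) (fun x => Re (f x)) 0 1) as [I1 H1].
  { rewrite Rmin_left, Rmax_right by lra; intros x Hx.
    apply (ex_derive_continuous (K := R_AbsRing) (V := R_NormedModule)), H, Hx. }
  destruct (ex_RInt_continuous (V := R_CompleteNormedModule) (fun x => Im (f x)) 0 1) as [I2 H2].
  { rewrite Rmin_left, Rmax_right by lra; intros x Hx.
    apply (ex_derive_continuous (K := R_AbsRing) (V := R_NormedModule)), H, Hx. }
  exists (I1, I2); apply CRInt_pair; split; assumption.
Qed.

(** * Lower bounds for the denominator on the closed disc *)

Lemma Cmod_denom_ge (w : C) (s : R) :
  Cmod w <= 1 -> 0 <= s <= 1 -> 1 - s <= Cmod (1 - w * s).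
Proof.
  intros Hw Hs.
  assert (Cmod 1 <= Cmod (1 - w * s) + Cmod (w * s)).
  { replace (RtoC 1) with ((1 - w * s) + w * s)%C at 1 by ring; apply Cmod_triangle. }
  rewrite Cmod_1, Cmod_mult, Cmod_R, Rabs_pos_eq in H by lra.
  pose proof (Cmod_ge_0 w); nra.
Qed.

(** From [1 - w = (1 - w s) - w (1 - s)] and [1 - s <= |1 - w s|]. For [w] other than 1 this keeps
    the denominator away from 0 uniformly in [s]. *)
Lemma Cmod_denom_ge_half (w : C) (s : R) :
  Cmod w <= 1 -> 0 <= s <= 1 -> Cmod (1 - w) <= 2 * Cmod (1 - w * s).
Proof.
  intros Hw Hs; pose proof (Cmod_denom_ge w s Hw Hs).
  replace (1 - w)%C with ((1 - w * s) + - (w * (1 - s)))%C by ring.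
  eapply Rle_trans; [apply Cmod_triangle|].
  rewrite Cmod_opp, Cmod_mult, <- RtoC_minus, Cmod_R, Rabs_pos_eq by lra.
  pose proof (Cmod_ge_0 w); nra.
Qed.

Lemma Cminus_neq0 (x y : C) : x <> y -> 0 < Cmod (x - y).
Proof.
  intros H; apply Cmod_gt_0; intros E; apply H.
  replace x with ((x - y) + y)%C by ring; rewrite E; ring.
Qed.

Lemma pow_01 (x : R) (n : nat) : 0 <= x <= 1 -> 0 <= x ^ n <= 1.
Proof.
  intros H; split; [apply pow_le; lra|].
  rewrite <- (pow1 n); apply pow_incr; lra.
Qed.

Lemma denom_neq0 (z : C) (a : nat) (x : R) :
  Cmod z <= 1 -> z <> 1 -> 0 <= x <= 1 -> (1 - z * Cpow x a)%C <> RtoC 0.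
Proof.
  intros Hz Hz1 Hx; rewrite <- RtoC_pow; apply Cmod_gt_0.
  pose proof (Cmod_denom_ge_half z (x ^ a) Hz (pow_01 x a Hx)).
  assert (0 < Cmod (1 - z)) by (apply Cminus_neq0; auto).
  lra.
Qed.

Lemma pow_le_1r (x : R) (m n : nat) : 0 <= x <= 1 -> (m <= n)%nat -> x ^ n <= x ^ m.
Proof.
  intros Hx H; replace n with (m + (n - m))%nat by lia; rewrite pow_add.
  pose proof (pow_01 x m Hx); pose proof (pow_01 x (n - m) Hx); nra.
Qed.

Lemma geom_rsum (x : R) (n : nat) : rsum (pow x) n * (1 - x) = 1 - x ^ n.
Proof.
  induction n as [|n IH]; simpl; [ring|].
  rewrite Rmult_plus_distr_r, IH; ring.
Qed.

Lemma integrand_RInt (a b l : nat) (z : C) :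
  (0 < a)%nat -> Cmod z <= 1 -> z <> 1 \/ l = 0%nat ->
  exists I : C, is_CRInt (integrand a b l z) 0 1 I.
Proof.
  intros Ha Hz H.
  assert (Hid : forall x, smooth (fun t => RtoC t) x)
    by (intros x; apply smooth_RtoC, ex_derive_id).
  destruct (Ceq_dec z 1) as [E|Hz1].
  - destruct H as [H | ->]; [contradiction|]; subst z.
    (* For [z = 1] and [l = 0] the factor [1 - x] cancels: [1 - x^a = (1 - x) (1 + x + ... +
       x^(a-1))]. The two integrands need to agree only on the open interval. *)
    destruct (smooth_RInt (fun x => (Cpow x (b + a * 0 - 1) * / RtoC (rsum (pow x) a))%C)) as [I HI].
    + intros x Hx; apply smooth_mult; [apply smooth_Cpow, Hid|].
      apply smooth_inv.
      * apply smooth_RtoC; generalize a; intros n; induction n as [|n IH].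
        -- exact (ex_derive_const 0 x).
        -- apply (ex_derive_plus (V := R_NormedModule) (fun t => rsum (pow t) n) (fun t => t ^ n));
             [exact IH | auto_derive; exact I].
      * intros E; apply RtoC_inj in E.
        assert (forall n, 1 <= rsum (pow x) (S n)).
        { induction n as [|n IH]; [simpl; lra|].
          rewrite rsum_S; pose proof (pow_01 x (S n) Hx); lra. }
        specialize (H (a - 1)%nat); replace (S (a - 1)) with a in H by lia; lra.
    + exists I; apply (is_RInt_ext (V := C_R_NormedModule)) with (2 := HI).
      rewrite Rmin_left, Rmax_right by lra; intros x Hx.
      pose proof (geom_rsum x a) as Hg.
      assert (x ^ a < 1) by (apply pow_lt_1_compat; [lra | exact Ha]).
      assert (rsum (pow x) a <> 0) by nra.
      unfold integrand; rewrite Cpow_1_r, Cmult_1_l.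
      rewrite <- (RtoC_pow x a), <- !RtoC_minus, <- Hg, RtoC_mult.
      assert (RtoC (rsum (pow x) a) <> 0) by (intros E; apply RtoC_inj in E; lra).
      assert (RtoC (1 - x) <> 0) by (intros E; apply RtoC_inj in E; lra).
      match goal with |- ?u = ?v => change (u = v :> C) end; field; auto.
  - apply smooth_RInt; intros x Hx; unfold integrand.
    apply smooth_mult; [apply smooth_mult|apply smooth_inv].
    + apply smooth_Cpow, Hid.
    + apply smooth_minus; [apply smooth_const | apply Hid].
    + apply smooth_Cpow, smooth_minus; [apply smooth_const|].
      apply smooth_mult; [apply smooth_const | apply smooth_Cpow, Hid].
    + apply Cpow_nz, denom_neq0; assumption.
Qed.

Lemma geom_psum (y : C) (n : nat) : ((1 - y) * psum (Cpow y) n = 1 - Cpow y n)%C.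
Proof.
  induction n as [|n IH]; simpl; [ring|].
  rewrite Cmult_plus_distr_l, IH; ring.
Qed.

Lemma psum_scal (w : C) (u : nat -> C) (n : nat) :
  psum (fun k => w * u k)%C n = (w * psum u n)%C.
Proof. induction n as [|n IH]; simpl; [|rewrite IH]; ring. Qed.

(* The geometric expansion of the integrand to order [M] leaves a remainder
   of modulus at most [x ^ M], since [1 - x <= |1 - w x^a|] on the closed disc. *)
Lemma integral_series (a b : nat) (w I : C) :
  (0 < a)%nat -> (0 < b)%nat -> Cmod w <= 1 ->
  is_CRInt (integrand a b 0 w) 0 1 I ->
  is_Cseries (fun n => Cpow w n *
     RtoC (/ (INR a * INR n + INR b) - / (INR a * INR n + INR b + 1)))%C I.
Proof.
  intros Ha Hb Hw HI; apply is_series_psum.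
  apply is_lim_seq_squeeze0 with (2 := is_lim_seq_inv_S).
  intros M; split; [apply Cmod_ge_0|].
  set (t := fun (n : nat) (x : R) => (Cpow w n * RtoC (x ^ (a * n + b - 1) - x ^ (a * n + b)))%C).
  assert (HT : is_CRInt (fun x => psum (fun n => t n x) M) 0 1
     (psum (fun n => Cpow w n *
     RtoC (/ (INR a * INR n + INR b) - / (INR a * INR n + INR b + 1)))%C M)).
  { clear - Hb; induction M as [|M IH]; simpl psum.
    - exact (CRInt_RtoC _ _ _ _ (RInt_const_01 0)).
    - apply CRInt_plus; [exact IH|].
      apply CRInt_scal, CRInt_RtoC.
      assert (Hr : forall n : nat, (0 < n)%nat -> is_RInt (fun x => x ^ (n - 1)) 0 1 (/ INR n)).
      { intros n Hn; pose proof (RInt_pow (n - 1)) as Hp.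
        replace (S (n - 1)) with n in Hp by lia; exact Hp. }
      rewrite <- mult_INR, <- plus_INR, <- S_INR.
      apply (is_RInt_minus (V := R_NormedModule)); [apply Hr; lia | apply RInt_pow]. }
  rewrite <- Cmod_opp.
  replace (- _)%C with (I - psum (fun n => Cpow w n *
     RtoC (/ (INR a * INR n + INR b) - / (INR a * INR n + INR b + 1)))%C M)%C by ring.
  apply CRInt_norm_le with (2 := CRInt_minus _ _ _ _ _ _ HI HT) (3 := RInt_pow M).
  intros x Hx.
  assert (Et : psum (fun n => t n x) M =
     (RtoC (x ^ (b - 1) * (1 - x)) * psum (Cpow (w * RtoC (x ^ a))) M)%C).
  { rewrite <- psum_scal; apply psum_ext; intros n _; unfold t.
    rewrite Cpow_mult_l, <- RtoC_pow, <- pow_mult.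
    replace (a * n + b - 1)%nat with (a * n + (b - 1))%nat by lia.
    replace (a * n + b)%nat with (a * n + S (b - 1))%nat by lia.
    rewrite !pow_add; simpl pow; rewrite !RtoC_minus, !RtoC_mult, RtoC_minus; ring. }
  rewrite Et; unfold integrand; clear Et t HT.
  replace (b + a * 0 - 1)%nat with (b - 1)%nat by lia.
  rewrite Cpow_1_r, <- !RtoC_pow, <- RtoC_minus, <- RtoC_mult.
  (* At [x = 1] the denominator vanishes when [w = 1], but the numerator contains [1 - x], so both
     the integrand and the partial sum are 0. *)
  destruct (Req_dec x 1) as [->|Hx1].
  - replace (1 ^ (b - 1) * (1 - 1)) with 0 by ring.
    unfold Cdiv; rewrite !Cmult_0_l, pow1.
    replace (0 - 0)%C with (RtoC 0) by ring; rewrite Cmod_0; lra.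
  - pose proof (pow_01 x a Hx) as Hxa.
    pose proof (Cmod_denom_ge w (x ^ a) Hw Hxa) as Hd.
    pose proof (pow_le_1r x 1 a Hx Ha) as Hx1a; rewrite pow_1 in Hx1a.
    assert (Hn : (1 - w * RtoC (x ^ a))%C <> 0) by (apply Cmod_gt_0; lra).
    set (D := (1 - w * RtoC (x ^ a))%C) in *.
    replace (psum (Cpow (w * RtoC (x ^ a))) M) with
      ((1 - Cpow (w * RtoC (x ^ a)) M) / D)%C.
    2:{ rewrite <- geom_psum; fold D; field; exact Hn. }
    replace (_ - _)%C with
      (RtoC (x ^ (b - 1)) * (RtoC (1 - x) / D) * Cpow (w * RtoC (x ^ a)) M)%C
      by (rewrite RtoC_mult; field; exact Hn).
    rewrite !Cmod_mult, Cmod_div, Cmod_pow, Cmod_mult, !Cmod_R, !Rabs_pos_eq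
      by (try apply pow_01; try lra; exact Hn).
    assert (H1 : 0 <= (1 - x) / Cmod D <= 1).
    { split; [apply Rdiv_le_0_compat; lra|].
      apply (Rmult_le_reg_r (Cmod D)); [lra|]; unfold Rdiv.
      rewrite Rmult_assoc, Rinv_l by lra; lra. }
    (* Uses [x^a <= x], which holds because [a >= 1]. *)
    assert (H2 : 0 <= (Cmod w * x ^ a) ^ M <= x ^ M).
    { pose proof (Cmod_ge_0 w); split; [apply pow_le; nra | apply pow_incr; nra]. }
    pose proof (pow_01 x (b - 1) Hx) as H3; pose proof (pow_01 x M Hx).
    assert (0 <= x ^ (b - 1) * ((1 - x) / Cmod D) <= 1) by nra.
    nra.
Qed.

(** With [s = x^a], the integrands combine exactly to [x^(b-1) (1-x)] times
    [(w-z)^2 s^2 / ((1 - w s) (1 - z s)^2)]; the extra power [x^a] in the integrand of [J] supplies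
    the factor [s] of the derivative in [z]. *)
Lemma integral_difference (a b : nat) (w z Iw Iz J : C) :
  (0 < b)%nat -> Cmod w <= 1 -> Cmod z <= 1 -> z <> 1 -> Cmod (1 - z) <= 2 * Cmod (1 - w) ->
  is_CRInt (integrand a b 0 w) 0 1 Iw -> is_CRInt (integrand a b 0 z) 0 1 Iz ->
  is_CRInt (integrand a b 1 z) 0 1 J ->
  Cmod (Iw - Iz - (w - z) * J) <= Cmod (w - z) ^ 2 * (16 / Cmod (1 - z) ^ 3).
Proof.
  intros Hb Hw Hz Hz1 Hwz HIw HIz HJ.
  assert (Hd : 0 < Cmod (1 - z)) by (apply Cminus_neq0; auto).
  set (d := Cmod (1 - z)) in *.
  apply CRInt_norm_le with (2 := CRInt_minus _ _ _ _ _ _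
    (CRInt_minus _ _ _ _ _ _ HIw HIz) (CRInt_scal (w - z) _ _ _ _ HJ))
    (g := fun _ => Cmod (w - z) ^ 2 * (16 / d ^ 3)).
  2:{ apply RInt_const_01. }
  intros x Hx; pose proof (pow_01 x a Hx) as Hs.
  pose proof (Cmod_denom_ge_half w _ Hw Hs) as Dw.
  pose proof (Cmod_denom_ge_half z _ Hz Hs) as Dz; fold d in Dz.
  unfold integrand.
  replace (b + a * 0 - 1)%nat with (b - 1)%nat by lia.
  replace (b + a * 1 - 1)%nat with (a + (b - 1))%nat by lia.
  rewrite (Cpow_add_r x), <- !RtoC_pow.
  set (s := x ^ a) in *; set (u := x ^ (b - 1)).
  assert (Nw : (1 - w * s)%C <> 0) by (apply Cmod_gt_0; lra).
  assert (Nz : (1 - z * s)%C <> 0) by (apply Cmod_gt_0; lra).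
  replace (_ - _)%C with (RtoC u * (1 - RtoC x) * (Cpow (w - z) 2 *
     (RtoC s * RtoC s)) * / ((1 - w * s) * Cpow (1 - z * s) 2))%C
    by (simpl Cpow; field; auto).
  assert (Hu : 0 <= u <= 1) by (apply pow_01, Hx).
  rewrite <- !RtoC_minus, !Cmod_mult, Cmod_inv, Cmod_mult, !Cmod_pow, !Cmod_R, !Rabs_pos_eq
    by first [lra | apply Cmult_neq_0; [exact Nw | apply Cpow_nz, Nz]].
  set (p := Cmod (1 - w * s)) in *; set (q := Cmod (1 - z * s)) in *.
  (* [q >= d/2] directly, and [p >= |1-w|/2 >= d/4]. *)
  assert (Hpq : d ^ 3 / 16 <= p * q ^ 2).
  { apply Rle_trans with (d / 4 * (d / 2) ^ 2); [apply Req_le; field|].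
    apply Rmult_le_compat; [lra | apply pow_le; lra | lra | apply pow_incr; lra]. }
  assert (Hd3 : 0 < d ^ 3) by (apply pow_lt, Hd).
  apply Rinv_le_contravar in Hpq; [|lra].
  replace (/ (d ^ 3 / 16)) with (16 / d ^ 3) in Hpq by (field; lra).
  assert (Hs2 : 0 <= s * s <= 1) by nra.
  assert (0 <= Cmod (w - z) ^ 2) by apply pow_le, Cmod_ge_0.
  assert (Hux : 0 <= u * (1 - x) <= 1) by nra.
  assert (H2 : 0 <= Cmod (w - z) ^ 2 * (s * s) <= Cmod (w - z) ^ 2) by nra.
  apply Rmult_le_compat; [|left|nra|exact Hpq].
  - apply Rmult_le_pos; lra.
  - apply Rinv_0_lt_compat, Rmult_lt_0_compat; [lra | apply pow_lt; lra].
Qed.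

(** * The derivative *)

Lemma Cmod_pow_le1 (z : C) (n : nat) : Cmod z <= 1 -> 0 <= Cmod (Cpow z n) <= 1.
Proof.
  intros Hz; rewrite Cmod_pow; apply pow_01; split; [apply Cmod_ge_0 | exact Hz].
Qed.

Lemma Cpow_diff_bound (w z : C) (n : nat) :
  Cmod w <= 1 -> Cmod z <= 1 -> Cmod (Cpow w n - Cpow z n) <= INR n * Cmod (w - z).
Proof.
  intros Hw Hz; induction n as [|n IH].
  - simpl; replace (1 - 1)%C with (RtoC 0) by ring; rewrite Cmod_0; lra.
  - replace (Cpow w (S n) - Cpow z (S n))%C with
      (Cpow w n * (w - z) + z * (Cpow w n - Cpow z n))%C by (simpl; ring).
    eapply Rle_trans; [apply Cmod_triangle|]; rewrite !Cmod_mult, S_INR.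
    pose proof (Cmod_pow_le1 w n Hw); pose proof (Cmod_ge_0 z).
    pose proof (Cmod_ge_0 (w - z)); pose proof (Cmod_ge_0 (Cpow w n - Cpow z n)); nra.
Qed.

(** First-order Taylor remainder at [z] of the power with exponent [n + 1]. The constant power has
    no remainder, whence the shift. *)
Definition taylor_rem (w z : C) (n : nat) : C :=
  (Cpow w (S n) - Cpow z (S n) - (w - z) * weight 1 z n)%C.

(** Weaker in [w - z] than the quadratic bound but of lower degree in [n]; this is the bound used
    for the tail. *)
Lemma taylor_rem_linear (w z : C) (n : nat) :
  Cmod w <= 1 -> Cmod z <= 1 ->
  Cmod (taylor_rem w z n) <= 2 * INR (n + 1) * Cmod (w - z).
Proof.
  intros Hw Hz; unfold taylor_rem, Cminus at 1.
  eapply Rle_trans; [apply Cmod_triangle|]; rewrite Cmod_opp, Cmod_mult.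
  pose proof (Cpow_diff_bound w z (S n) Hw Hz) as H1.
  pose proof (weight_bound 1 z n (or_intror eq_refl) Hz) as H2.
  rewrite Nat.add_1_r in *; pose proof (Cmod_ge_0 (w - z)); nra.
Qed.

Lemma taylor_rem_quadratic (w z : C) (n : nat) :
  Cmod w <= 1 -> Cmod z <= 1 ->
  Cmod (taylor_rem w z n) <= INR (n + 1) ^ 2 * Cmod (w - z) ^ 2.
Proof.
  intros Hw Hz; induction n as [|n IH].
  - unfold taylor_rem, weight; simpl Nat.add; simpl Cpow; simpl INR.
    replace (_ - _)%C with (RtoC 0) by (simpl pow; rewrite Rmult_1_r; ring).
    rewrite Cmod_0; pose proof (Cmod_ge_0 (w - z)); nra.
  - replace (taylor_rem w z (S n)) with
      (z * taylor_rem w z n + (w - z) * (Cpow w (S n) - Cpow z (S n)))%C.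
    2:{ unfold taylor_rem, weight; rewrite !pow_1, !INR_n1, S_INR, RtoC_plus; simpl Cpow; ring. }
    eapply Rle_trans; [apply Cmod_triangle|]; rewrite !Cmod_mult.
    pose proof (Cpow_diff_bound w z (S n) Hw Hz) as H1.
    rewrite !Nat.add_1_r in *; rewrite (S_INR (S n)).
    set (m := INR (S n)) in *; assert (0 <= m) by apply pos_INR.
    set (d := Cmod (w - z)) in *; assert (0 <= d) by apply Cmod_ge_0.
    pose proof (Cmod_ge_0 (taylor_rem w z n)); pose proof (Cmod_ge_0 z).
    assert (Cmod z * Cmod (taylor_rem w z n) <= m ^ 2 * d ^ 2) by nra.
    assert (d * Cmod (Cpow w (S n) - Cpow z (S n)) <= d * (m * d)) by (apply Rmult_le_compat_l; assumption).
    assert (0 <= m * d ^ 2) by (apply Rmult_le_pos; nra); nra.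
Qed.

(* The first [M] terms are bounded by [d ^ 2], the others by a telescoping sum. *)
Lemma psum_cut_bound (t : nat -> C) (d : R) (M n : nat) :
  0 <= d -> (forall k, Cmod (t k) <= d ^ 2) ->
  (forall k, Cmod (t k) <= 2 * d * (/ INR (k + 1) - / INR (k + 2))) ->
  Cmod (psum t n) <= d * (INR M * d + 2 / INR (M + 1)).
Proof.
  intros Hd H1 H2.
  assert (Hi : forall k, 0 < / INR (k + 1))
    by (intros k; apply Rinv_0_lt_compat, lt_0_INR; lia).
  assert (A : forall k, Cmod (psum t k) <= INR k * d ^ 2).
  { induction k as [|k IH]; simpl psum; [rewrite Cmod_0; simpl; lra|].
    eapply Rle_trans; [apply Cmod_triangle|]; rewrite S_INR; specialize (H1 k); lra. }
  assert (B : forall j, Cmod (psum t (M + j)) <=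
     INR M * d ^ 2 + 2 * d * (/ INR (M + 1) - / INR (M + j + 1))).
  { induction j as [|j IH].
    - rewrite Nat.add_0_r; specialize (A M); lra.
    - rewrite Nat.add_succ_r; simpl psum.
      eapply Rle_trans; [apply Cmod_triangle|]; specialize (H2 (M + j)%nat).
      replace (S (M + j) + 1)%nat with (M + j + 2)%nat by lia; lra. }
  unfold Rdiv; pose proof (Hi M) as HM.
  destruct (Nat.le_gt_cases n M) as [Hn|Hn].
  - specialize (A n); apply le_INR in Hn.
    assert (INR n * d ^ 2 <= INR M * d ^ 2) by (apply Rmult_le_compat_r; nra).
    assert (0 <= d * / INR (M + 1)) by (apply Rmult_le_pos; lra); nra.
  - specialize (B (n - M)%nat); replace (M + (n - M))%nat with n in B by lia.
    specialize (Hi n); assert (0 <= d * / INR (n + 1)) by (apply Rmult_le_pos; lra); nra.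
Qed.

Lemma trap_err_nat_bound (n N : nat) :
  (n + 1 <= N)%nat -> 0 <= trap_err (INR N) <= / (2 * INR (n + 1) ^ 3).
Proof.
  intros H.
  assert (Hn : 1 <= INR (n + 1)) by (apply (le_INR 1); lia).
  apply le_INR in H; pose proof (trap_err_bound (INR N) ltac:(lra)) as Ht.
  split; [apply Ht|]; eapply Rle_trans; [apply Ht|].
  assert (0 < INR (n + 1) ^ 3 <= INR N ^ 3) by (split; [apply pow_lt; lra | apply pow_incr; lra]).
  apply Rinv_le_contravar; lra.
Qed.

(** The left side is the sum of the Taylor remainders weighted by [h]. Cubic decay of [h] makes each
    term at most [d^2] by the quadratic bound and [d/m^2] by the linear one, with [d = |w - z|] and
    [m = n + 1]. The cut [M] stays free, to be fixed before [w] tends to [z]. *)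
Lemma trap_series_derivative (h : nat -> R) (w z Hw Hz S : C) (M : nat) :
  Cmod w <= 1 -> Cmod z <= 1 ->
  (forall n, 0 <= h (n + 1)%nat <= / (2 * INR (n + 1) ^ 3)) ->
  is_Cseries (fun n => Cpow w n * RtoC (h n))%C Hw ->
  is_Cseries (fun n => Cpow z n * RtoC (h n))%C Hz ->
  is_Cseries (fun n => weight 1 z n * RtoC (h (n + 1)%nat))%C S ->
  Cmod (Hw - Hz - (w - z) * S) <= Cmod (w - z) * (INR M * Cmod (w - z) + 2 / INR (M + 1)).
Proof.
  intros Aw Az Hh Sw Sz SS.
  apply Cseries_Cmod_le with (fun n => taylor_rem w z n * RtoC (h (n + 1)%nat))%C.
  (* The terms of index 0 do not depend on the point and cancel. *)
  - apply Cseries_shift in Sw; apply Cseries_shift in Sz.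
    pose proof (Cseries_minus _ _ _ _ (Cseries_minus _ _ _ _ Sw Sz) (Cseries_scal (w - z) _ _ SS)) as T.
    replace (Hw - Hz - (w - z) * S)%C with
      ((Hw - Cpow w 0 * RtoC (h 0%nat)) - (Hz - Cpow z 0 * RtoC (h 0%nat)) - (w - z) * S)%C
      by (simpl; ring).
    apply Cseries_ext with (2 := T); intros n; unfold taylor_rem.
    rewrite Nat.add_1_r; ring.
  - intros n; apply psum_cut_bound; [apply Cmod_ge_0| |]; clear n; intros n;
      rewrite Cmod_mult, Cmod_R, Rabs_pos_eq by apply Hh; specialize (Hh n).
    + pose proof (taylor_rem_quadratic w z n Aw Az) as H.
      assert (Hn : 1 <= INR (n + 1)) by (apply (le_INR 1); lia).
      set (m := INR (n + 1)) in *; set (d := Cmod (w - z)) in *.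
      apply Rle_trans with (m ^ 2 * d ^ 2 * / (2 * m ^ 3)).
      { apply Rmult_le_compat; [apply Cmod_ge_0 | lra | exact H | lra]. }
      replace (m ^ 2 * d ^ 2 * / (2 * m ^ 3)) with (d ^ 2 * / (2 * m)) by (field; lra).
      assert (/ (2 * m) <= 1) by (rewrite <- Rinv_1; apply Rinv_le_contravar; lra).
      nra.
    + pose proof (taylor_rem_linear w z n Aw Az) as H.
      assert (Hn : 1 <= INR (n + 1)) by (apply (le_INR 1); lia).
      replace (n + 2)%nat with (n + 1 + 1)%nat by lia; rewrite (plus_INR (n + 1) 1).
      change (INR 1) with 1.
      set (m := INR (n + 1)) in *; set (d := Cmod (w - z)) in *.
      assert (0 <= d) by apply Cmod_ge_0.
      apply Rle_trans with (2 * m * d * / (2 * m ^ 3)).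
      { apply Rmult_le_compat; [apply Cmod_ge_0 | lra | exact H | lra]. }
      replace (2 * m * d * / (2 * m ^ 3)) with (d * / m ^ 2) by (field; lra).
      replace (2 * d * (/ m - / (m + 1))) with (d * / (m * (m + 1) / 2)) by (field; lra).
      apply Rmult_le_compat_l; [assumption|]; apply Rinv_le_contravar; nra.
Qed.

Lemma gamma_series (a b : nat) (g : C -> C) (z I : C) :
  (0 < a)%nat -> (0 < b)%nat -> Cmod z <= 1 -> is_gamma (INR a) (INR b) g ->
  is_CRInt (integrand a b 0 z) 0 1 I ->
  is_Cseries (fun n => Cpow z n * RtoC (trap_err (INR (a * n + b))))%C (g z - 1 / 2 * I)%C.
Proof.
  intros Ha Hb Hz [Hg _] HI.
  specialize (Hg z Hz); apply is_pseries_Cseries in Hg.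
  apply integral_series in HI; try assumption.
  apply Cseries_ext with (2 := Cseries_minus _ _ _ _ Hg (Cseries_scal (1 / 2) _ _ HI)).
  intros n.
  assert (0 < INR b) by (apply lt_0_INR, Hb).
  pose proof (Rmult_le_pos _ _ (pos_INR a) (pos_INR n)).
  rewrite gamma_coef_split by lra.
  rewrite plus_INR, mult_INR, RtoC_plus.
  unfold Rdiv; rewrite RtoC_mult, RtoC_inv by lra; field.
Qed.

Lemma derivative_along (g : C -> C) (z D : C) (e : R) :
  is_derive (K := C_AbsRing) (V := C_NormedModule) g z D -> 0 < e ->
  exists r, 0 < r /\ forall w, Cmod (w - z) < r ->
    Cmod (g w - g z - (w - z) * D) <= e * Cmod (w - z).
Proof.
  intros [_ H] He.
  destruct (H z (fun P HP => HP) (mkposreal e He)) as [r Hr].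
  exists r; split; [apply cond_pos|].
  intros w Hw; exact (Hr w Hw).
Qed.

(* [g] is known only on the closed disc, so its derivative at a point [z] of
   the circle is read off along the segment from [z] to [1]. *)
Lemma derivative_of_segment (g : C -> C) (z D V : C) (K : R) :
  Cmod z <= 1 -> z <> 1 -> is_derive (K := C_AbsRing) (V := C_NormedModule) g z D ->
  0 <= K ->
  (forall (t : R) (M : nat), 0 < t <= 1 / 2 -> let w := (z + t * (1 - z))%C in
     Cmod (g w - g z - (w - z) * V) <=
     Cmod (w - z) * ((INR M + K) * Cmod (w - z) + 2 / INR (M + 1))) ->
  D = V.
Proof.
  intros Hz Hz1 HD HK H.
  destruct (Ceq_dec D V) as [E|E]; [exact E|exfalso].
  assert (He : 0 < Cmod (D - V)) by (apply Cminus_neq0, E); set (e := Cmod (D - V)) in *.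
  destruct (derivative_along g z D (e / 3) HD ltac:(lra)) as [r [Hr Hrw]].
  assert (Hd : 0 < Cmod (1 - z)) by (apply Cminus_neq0; auto); set (d := Cmod (1 - z)) in *.
  (* [M] is fixed first, to make the tail [2/(M+1)] less than [e/6]; [t] is chosen afterwards,
     depending on [M]. *)
  destruct (archimed_cor1 (e / 12) ltac:(lra)) as [M [HM1 HM2]].
  assert (HM : 2 / INR (M + 1) < e / 6).
  { assert (/ INR (M + 1) <= / INR M).
    { apply Rinv_le_contravar; [apply lt_0_INR, HM2 | apply le_INR; lia]. }
    unfold Rdiv; lra. }
  assert (HMK : 0 < INR M + K) by (apply lt_0_INR in HM2; lra).
  (* The three bounds keep [t] admissible, [|w - z| = t d] below [r], and [(M + K) t d] at most
     [e/12]. The total error relative to [|w - z|] is then at most [e/3 + e/12 + e/6], less than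
     [e]. *)
  set (t := Rmin (1 / 2) (Rmin (r / (2 * d)) (e / (12 * (INR M + K) * d)))).
  assert (Ht : 0 < t <= 1 / 2).
  { split; [|apply Rmin_l].
    repeat apply Rmin_pos; [lra| |];
      apply Rdiv_lt_0_compat; try lra; repeat apply Rmult_lt_0_compat; lra. }
  assert (Ht1 : t * d <= r / 2).
  { apply Rle_trans with (r / (2 * d) * d); [|apply Req_le; field; lra].
    apply Rmult_le_compat_r; [lra|]; unfold t.
    eapply Rle_trans; [apply Rmin_r | apply Rmin_l]. }
  assert (Ht2 : (INR M + K) * (t * d) <= e / 12).
  { apply Rle_trans with ((INR M + K) * (e / (12 * (INR M + K) * d) * d));
      [|apply Req_le; field; lra].
    apply Rmult_le_compat_l; [lra|]; apply Rmult_le_compat_r; [lra|]; unfold t.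
    eapply Rle_trans; [apply Rmin_r | apply Rmin_r]. }
  specialize (H t M Ht); set (w := (z + t * (1 - z))%C) in *; simpl in H.
  assert (Hwz : Cmod (w - z) = t * d).
  { replace (w - z)%C with (t * (1 - z))%C by (unfold w; ring).
    rewrite Cmod_mult, Cmod_R, Rabs_pos_eq by lra; reflexivity. }
  specialize (Hrw w ltac:(lra)); rewrite Hwz in *.
  assert (Htd : 0 < t * d) by nra.
  assert (T : t * d * e <= e / 3 * (t * d) + t * d * ((INR M + K) * (t * d) + 2 / INR (M + 1))).
  { rewrite <- Hwz at 1; unfold e at 1; rewrite <- Cmod_mult.
    replace ((w - z) * (D - V))%C with
      (- (g w - g z - (w - z) * D) + (g w - g z - (w - z) * V))%C by ring.
    eapply Rle_trans; [apply Cmod_triangle|]; rewrite Cmod_opp; lra. }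
  assert (t * d * ((INR M + K) * (t * d) + 2 / INR (M + 1)) <= t * d * (e / 4))
    by (apply Rmult_le_compat_l; lra).
  nra.
Qed.

(** Analyticity off the ray gives the existence of the derivative; the estimates for the integral
    and the series along the segment then identify its value. *)
Lemma gamma_derivative (a b : nat) (g : C -> C) (z J S : C) :
  (0 < a)%nat -> (0 < b)%nat -> Cmod z <= 1 -> z <> 1 -> is_gamma (INR a) (INR b) g ->
  is_CRInt (integrand a b 1 z) 0 1 J ->
  is_Cseries (fun n => weight 1 z n * RtoC (trap_err (INR (a * n + (b + a * 1)))))%C S ->
  is_derive (K := C_AbsRing) (V := C_NormedModule) g z (1 / 2 * J + S)%C.
Proof.
  intros Ha Hb Hz Hz1 Hg HJ HS.
  assert (Hex : ex_derive (K := C_AbsRing) (V := C_NormedModule) g z).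
  (* The closed disc meets the ray only at 1. *)
  { apply (proj2 Hg); intros [Him Hre]; apply Hz1.
    pose proof (re_le_Cmod z) as Hr; pose proof (Rle_abs (Re z)).
    apply injective_projections; [|exact Him].
    change (Re z = 1); lra. }
  destruct Hex as [D HD].
  assert (Hd : 0 < Cmod (1 - z)) by (apply Cminus_neq0; auto).
  destruct (integrand_RInt a b 0 z Ha Hz (or_intror eq_refl)) as [Iz HIz].
  (* The constant is half of the one in [integral_difference], as the integral enters [g] with the
     factor [1/2]. *)
  rewrite <- (derivative_of_segment g z D (1 / 2 * J + S)%C (8 / Cmod (1 - z) ^ 3)); auto.
  { apply Rdiv_le_0_compat; [lra | apply pow_lt, Hd]. }
  intros t M Ht w.
  assert (Hw : Cmod w <= 1).
  { replace w with ((1 - t) * z + t)%C by (unfold w; ring).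
    eapply Rle_trans; [apply Cmod_triangle|].
    rewrite <- RtoC_minus, Cmod_mult, !Cmod_R, !Rabs_pos_eq by lra; nra. }
  (* This is where [t <= 1/2] is needed: [|1 - w| = (1 - t) |1 - z|]. *)
  assert (Hw1 : Cmod (1 - z) <= 2 * Cmod (1 - w)).
  { replace (1 - w)%C with ((1 - t) * (1 - z))%C by (unfold w; ring).
    rewrite <- RtoC_minus, Cmod_mult, Cmod_R, Rabs_pos_eq by lra; nra. }
  destruct (integrand_RInt a b 0 w Ha Hw (or_intror eq_refl)) as [Iw HIw].
  pose proof (integral_difference a b w z Iw Iz J Hb Hw Hz Hz1 Hw1 HIw HIz HJ) as BI.
  pose proof (trap_series_derivative (fun n => trap_err (INR (a * n + b))) w z _ _ S M Hw Hz
    ltac:(intros n; apply trap_err_nat_bound; nia)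
    (gamma_series a b g w Iw Ha Hb Hw Hg HIw) (gamma_series a b g z Iz Ha Hb Hz Hg HIz)) as BS.
  match type of BS with ?A -> _ => assert (HA : A); [|specialize (BS HA)] end.
  (* The index shift by one matches [a (n+1) + b = a n + (b + a)]. *)
  { apply Cseries_ext with (2 := HS); intros n; do 4 f_equal; lia. }
  replace (g w - g z - (w - z) * (1 / 2 * J + S))%C with
    (1 / 2 * (Iw - Iz - (w - z) * J) +
     ((g w - 1 / 2 * Iw) - (g z - 1 / 2 * Iz) - (w - z) * S))%C by field.
  eapply Rle_trans; [apply Cmod_triangle|].
  rewrite Cmod_mult; replace (Cmod (1 / 2)) with (1 / 2).
  2:{ rewrite <- RtoC_div, Cmod_R, Rabs_pos_eq by lra; reflexivity. }
  unfold Rdiv in *; nra.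
Qed.

Lemma weighted_trap_series_exists (a b : nat) (z : C) :
  (0 < a)%nat -> (0 < b)%nat -> Cmod z <= 1 ->
  exists S : C, is_Cseries (fun n => weight 1 z n * RtoC (trap_err (INR (a * n + (b + a * 1)))))%C S.
Proof.
  intros Ha Hb Hz; apply Cseries_exists with 1; intros n.
  rewrite Cmod_mult, Cmod_R.
  pose proof (trap_err_nat_bound n (a * n + (b + a * 1)) ltac:(nia)) as Ht.
  pose proof (weight_bound 1 z n (or_intror eq_refl) Hz) as Hw.
  rewrite Rabs_pos_eq by apply Ht.
  replace (n + 2)%nat with (n + 1 + 1)%nat by lia; rewrite (plus_INR (n + 1) 1).
  change (INR 1) with 1.
  assert (Hn : 1 <= INR (n + 1)) by (apply (le_INR 1); lia).
  set (m := INR (n + 1)) in *.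
  apply Rle_trans with (m * / (2 * m ^ 3)).
  { apply Rmult_le_compat; [apply Cmod_ge_0 | apply Ht | exact Hw | apply Ht]. }
  replace (m * / (2 * m ^ 3)) with (/ (2 * m ^ 2)) by (field; lra).
  rewrite Rmult_1_l; apply Rinv_le_contravar; nra.
Qed.

(** * Assembly of the formula for [l = 0] and [l = 1] *)

Theorem theorem5 :
  forall (a b B l : nat) (z : C) (g : C -> C) (c : nat -> C),
    (0 < a)%nat -> (0 < b)%nat -> (1 < B)%nat ->
    Cmod z <= 1 ->
    (l = 0%nat \/ l = 1%nat) ->
    (Cpow (z - 1) 2 + Cpow (RtoC (INR l) - 1) 2)%C <> RtoC 0 ->
    is_gamma (INR a) (INR b) g ->
    is_gen_coef a b B l z c ->
    exists I S : C,
      is_RInt (V := C_R_NormedModule) (integrand a b l z) 0 1 I /\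
      is_series (K := C_AbsRing) (V := C_NormedModule)
        (fun k => c (k + 1)%nat * RtoC (P B (INR (k + 1)) / Q B (INR (k + 1))))%C S /\
      is_deriv01 g l z (1 / 2 * I + S)%C.
Proof.
  intros a b B l z g c Ha Hb HB Hz Hl Hne Hg Hc.
  assert (Hz1 : z <> 1 \/ l = 0%nat).
  { destruct Hl as [-> | ->]; [right; reflexivity | left].
    intros ->; apply Hne; simpl; ring. }
  destruct (integrand_RInt a b l z Ha Hz Hz1) as [I HI].
  (* Both values of [l] share the passage from the weighted trapezoidal errors to the series in
     [P / Q]; only the identification of the sum with [g] or its derivative differs. *)
  assert (HS : forall S : C,
    is_Cseries (fun n => weight l z n * RtoC (trap_err (INR (a * n + (b + a * l)))))%C S ->
    is_Cseries (fun k => c (k + 1)%nat * RtoC (P B (INR (k + 1)) / Q B (INR (k + 1))))%C S).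
  { intros S HS; apply coef_series with (spread a (b + a * l) (weight l z)).
    - exact HB.
    - intros k; apply spread_bound; [exact Ha | lia | intros n; apply weight_bound; assumption].
    - exact (gen_coef_0 a b B l z c Hb HB Hc).
    - apply gen_coef_rec; assumption.
    - apply Cseries_ext with (2 := Cseries_spread a (b + a * l) _ _ Ha HS).
      intros k; apply (spread_mult a (b + a * l) (weight l z)
        (fun k => RtoC (trap_err (INR k)))), Ha. }
  destruct Hl as [-> | ->].
  - exists I, (g z - 1 / 2 * I)%C; split; [exact HI | split].
    + apply HS, Cseries_ext with (2 := gamma_series a b g z I Ha Hb Hz Hg HI).
      intros n; unfold weight; rewrite Nat.mul_0_r, Nat.add_0_r; simpl pow; ring.
    + simpl; ring.
  - destruct Hz1 as [Hz1 | Hz1]; [|discriminate].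
    destruct (weighted_trap_series_exists a b z Ha Hb Hz) as [S HSe].
    exists I, S; split; [exact HI | split; [apply HS, HSe|]].
    apply (gamma_derivative a b); assumption.
Qed.
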